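(* Let $f\in\Gamma_0(\mathcal{X})$, $g\in\Gamma_0(\mathcal{K})$ and $A\in\mathcal{B}(\mathcal{X},\mathcal{K})$ satisfy $\mathcal{S}_p:=\operatorname{argmin}_{x\in\mathcal{X}}[f(x)+g(Ax)]\neq\varnothing$ and the qualification condition $0\in\operatorname{sri}(\operatorname{dom}(g)-A\operatorname{dom}(f))$. Suppose that $\Psi\in\Gamma_0(\mathcal{X})$ is Gâteaux differentiable with Lipschitzian gradient $\nabla\Psi$ over $\mathcal{X}$ and that $\Omega:=\operatorname{argmin}_{x^\star\in\mathcal{S}_p}\Psi(x^\star)\neq\varnothing$. Define the operator $\mathbf{T}_{\rm DRS_I}:\mathcal{X}\times\mathcal{K}\to\mathcal{X}\times\mathcal{K}:(x,y)\mapsto(x_T,y_T)$ by $$\begin{aligned} p&=x-A^*(\mathrm{I}+AA^* )^{-1}(Ax-y),\\ (x_{1/2},y_{1/2})&=(2p-x,\,2Ap-y),\\ (x_T,y_T)&=(2\operatorname{prox}_f(x_{1/2})-x_{1/2},\ 2\operatorname{prox}_g(y_{1/2})-y_{1/2}).\end{aligned}$$ Then $\mathbf{T}_{\rm DRS_I}$ can be plugged into the hybrid steepest descent method, with any $\alpha\in(0,1)$ and any $(\lambda_{n+1})_{n\in\mathbb{N}}\in\ell_+^2\setminus\ell_+^1$, as $$\begin{aligned}(x_{n+1/2},y_{n+1/2})&=(1-\alpha)(x_n,y_n)+\alpha\mathbf{T}_{\rm DRS_I}(x_n,y_n),\\ x_{n+1}^\star&=x_{n+1/2}-A^*(\mathrm{I}+AA^*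 )^{-1}(Ax_{n+1/2}-y_{n+1/2}),\\ x_{n+1}&=x_{n+1/2}-\lambda_{n+1}\bigl(\mathrm{I}-A^*(\mathrm{I}+AA^* )^{-1}A\bigr)\nabla\Psi(x_{n+1}^\star),\\ y_{n+1}&=y_{n+1/2}-\lambda_{n+1}(\mathrm{I}+AA^* )^{-1}A\,\nabla\Psi(x_{n+1}^\star),\end{aligned}$$ and, for any $(x_0,y_0)\in\mathcal{X}\times\mathcal{K}$, this algorithm generates a sequence $(x_{n+1}^\star)_{n\in\mathbb{N}}\subset\mathcal{X}$ which satisfies $\lim_{n\to\infty}d_\Omega(x_n^\star)=0$ if $\dim(\mathcal{X}\times\mathcal{K})<\infty$ and $\operatorname{Fix}(\mathbf{T}_{\rm DRS_I})$ is bounded.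
   Context: $\mathcal{X}$ and $\mathcal{K}$ are real Hilbert spaces; $\mathcal{X}\times\mathcal{K}$ is the product Hilbert space with inner product the sum of the componentwise inner products. $\mathcal{B}(\mathcal{X},\mathcal{K})$ is the set of bounded linear operators, $A^*$ is the adjoint of $A$, and $\mathrm{I}$ is the identity. $\Gamma_0(\mathcal{X})$ is the set of proper lower semicontinuous convex functions $\mathcal{X}\to(-\infty,\infty]$; $\operatorname{dom}(f)=\{x: f(x)<\infty\}$. For a convex set $C$, $\operatorname{sri}(C)=\{x\in C:\operatorname{cone}(C-x)=\overline{\operatorname{span}}(C-x)\}$ where $\operatorname{cone}(S)=\{\lambda s:\lambda>0,s\in S\}$. $\operatorname{prox}_f(x)=\operatorname{argmin}_{y}\, f(y)+\frac12\|x-y\|^2$. $\operatorname{Fix}(T)=\{z: T(z)=z\}$. $d_\Omega(x)=\min_{y\in\Omega}\|x-y\|$. $\ell_+^1$ (resp. $\ell_+^2$) is the set of summable (resp. square-summable) nonnegative real sequences. The hybrid steepest descent method for minimizing a Gâteaux differentiable convex function $\Theta$ over $\operatorname{Fix}(T)$, with $T$ nonexpansive (i.e. $1$-Lipschitz), is the iteration $z_{n+1}=T(z_n)-\lambda_{n+1}\nabla\Theta(T(z_n))$; the displayed algorithm is this iteration on $\mathcal{X}\times\mathcal{K}$ for the operator $(1-\alpha)\mathrm{I}+\alpha\mathbf{T}_{\rm DRS_I}$ and $\Theta=\Psi\circ\Xi$, where $\Xi(x,y)=x-A^*(\mathrm{I}+AA^* )^{-1}(Ax-y)$. *)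

(* Defs.v *)
From HB Require Import structures.
From mathcomp Require Import all_boot all_order all_algebra.
From mathcomp Require Import all_classical all_reals all_analysis.
From mathcomp Require Import ring lra.
Set Implicit Arguments.
Unset Strict Implicit.
Unset Printing Implicit Defensive.
Import Order.TTheory GRing.Theory Num.Theory.
Import numFieldNormedType.Exports.
Local Open Scope classical_set_scope.
Local Open Scope ring_scope.

(* A real Hilbert space: a complete normed module whose norm comes from a
   symmetric bilinear form.  Definiteness of [inner] follows from that of the
   norm. *)
HB.mixin Record CompleteNormedModule_isHilbert (R : realType) H
    of CompleteNormedModule R H := {
  inner : H -> H -> R ;
  innerC : forall x y, inner x y = inner y x ;
  innerPl : forall (a : R) x y z,
    inner (a *: x + y) z = a * inner x z + inner y z ;
  inner_sqr : forall x, inner x x = `|x| ^+ 2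
}.

#[short(type="hilbertType")]
HB.structure Definition Hilbert (R : realType) :=
  {H of CompleteNormedModule R H & CompleteNormedModule_isHilbert R H}.

(* [X * K] is already a normed module in the library, for the maximum norm.
   The alias [hprod X K] carries the Euclidean norm instead. *)
Definition hprod (R : realType) (X K : hilbertType R) : Type := (X * K)%type.

Section real_inequalities.
Context (R : realFieldType).

Fact euclid_sum (a b c d n m : R) : n ^+ 2 = a ^+ 2 + c ^+ 2 ->
  m ^+ 2 = b ^+ 2 + d ^+ 2 -> a * b + c * d <= n * m ->
  (a + b) ^+ 2 + (c + d) ^+ 2 <= (n + m) ^+ 2.
Proof. by move=> h1 h2 h3; rewrite [leRHS]sqrrD h1 h2; lra. Qed.

Fact half_sum (e : R) : (e / 2) ^+ 2 + (e / 2) ^+ 2 <= e ^+ 2.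
Proof. by have := sqr_ge0 e; lra. Qed.

End real_inequalities.

Section hprod_hilbert.
Context (R : realType) (X K : hilbertType R).
Notation XK := (hprod X K).

HB.instance Definition _ := GRing.Lmodule.copy XK (X * K)%type.

Let hinner (u v : XK) : R := inner u.1 v.1 + inner u.2 v.2.
Let hnorm (u : XK) : R := Num.sqrt (hinner u u).

Let hinnerE u : hinner u u = `|u.1| ^+ 2 + `|u.2| ^+ 2.
Proof. by rewrite /hinner !inner_sqr. Qed.

Let hnorm_sqr u : hnorm u ^+ 2 = hinner u u.
Proof. by rewrite sqr_sqrtr// hinnerE addr_ge0 ?sqr_ge0. Qed.

Let hnorm_le u e : 0 <= e -> (hnorm u <= e) = (`|u.1| ^+ 2 + `|u.2| ^+ 2 <= e ^+ 2).
Proof. by move=> e0; rewrite -ler_sqr ?nnegrE ?sqrtr_ge0// hnorm_sqr hinnerE. Qed.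

Let le_hnorm1 u : `|u.1| <= hnorm u.
Proof.
by rewrite -ler_sqr ?nnegrE ?sqrtr_ge0// hnorm_sqr hinnerE lerDl sqr_ge0.
Qed.

Let le_hnorm2 u : `|u.2| <= hnorm u.
Proof.
by rewrite -ler_sqr ?nnegrE ?sqrtr_ge0// hnorm_sqr hinnerE lerDr sqr_ge0.
Qed.

Let hnormD u v : hnorm (u + v) <= hnorm u + hnorm v.
Proof.
have nu : 0 <= hnorm u by exact: sqrtr_ge0.
have nv : 0 <= hnorm v by exact: sqrtr_ge0.
have h1 := ler_normD u.1 v.1; have h2 := ler_normD u.2 v.2.
rewrite hnorm_le ?addr_ge0//=.
have su : hnorm u ^+ 2 = `|u.1| ^+ 2 + `|u.2| ^+ 2 by rewrite hnorm_sqr hinnerE.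
have sv : hnorm v ^+ 2 = `|v.1| ^+ 2 + `|v.2| ^+ 2 by rewrite hnorm_sqr hinnerE.
have cs : `|u.1| * `|v.1| + `|u.2| * `|v.2| <= hnorm u * hnorm v.
  rewrite -ler_sqr ?nnegrE ?addr_ge0 ?mulr_ge0//.
  rewrite [leRHS]exprMn su sv -subr_ge0.
  suff -> : (`|u.1| ^+ 2 + `|u.2| ^+ 2) * (`|v.1| ^+ 2 + `|v.2| ^+ 2) -
    (`|u.1| * `|v.1| + `|u.2| * `|v.2|) ^+ 2 =
    (`|u.1| * `|v.2| - `|u.2| * `|v.1|) ^+ 2 by exact: sqr_ge0.
  by ring.
have {}h1 : `|u.1 + v.1| ^+ 2 <= (`|u.1| + `|v.1|) ^+ 2.
  by rewrite ler_sqr ?nnegrE ?addr_ge0.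
have {}h2 : `|u.2 + v.2| ^+ 2 <= (`|u.2| + `|v.2|) ^+ 2.
  by rewrite ler_sqr ?nnegrE ?addr_ge0.
apply: le_trans (lerD h1 h2) _.
exact: euclid_sum su sv cs.
Qed.

Let hnormZ (a : R) u : hnorm (a *: u) = `|a| * hnorm u.
Proof.
rewrite /hnorm !hinnerE/= !normrZ !exprMn -mulrDr sqrtrM ?sqr_ge0//.
by rewrite sqrtr_sqr normr_id.
Qed.

Let hnorm0_eq0 u : hnorm u = 0 -> u = 0.
Proof.
move=> u0; have := le_hnorm1 u; have := le_hnorm2 u; rewrite u0 !normr_le0.
by case: u {u0} => u1 u2 /= /eqP-> /eqP->.
Qed.

HB.instance Definition _ :=
  @Lmodule_isNormed.Build R XK hnorm hnormD hnormZ hnorm0_eq0.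

Let hprod_normE (u : XK) : `|u| = hnorm u. Proof. by []. Qed.

Let hprod_cauchy_cvg (F : set_system XK) : ProperFilter F -> cauchy F -> cvg F.
Proof.
move=> FF /cauchy_ballP Fc.
have c1 : cvg (fst @ F).
  apply/cauchy_cvgP/cauchy_ballP => e e0; rewrite near_map2.
  have := Fc e e0; apply: filterS => -[u v] /=.
  rewrite -!ball_normE/=; apply: le_lt_trans.
  exact: (le_hnorm1 (u - v)).
have c2 : cvg (snd @ F).
  apply/cauchy_cvgP/cauchy_ballP => e e0; rewrite near_map2.
  have := Fc e e0; apply: filterS => -[u v] /=.
  rewrite -!ball_normE/=; apply: le_lt_trans.
  exact: (le_hnorm2 (u - v)).
apply/cvg_ex; exists ((lim (fst @ F), lim (snd @ F)) : XK).
apply/cvgrPdist_le => e e0.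
have e20 : 0 < e / 2 by rewrite divr_gt0.
have /cvgrPdist_le/(_ _ e20) H1 := c1.
have /cvgrPdist_le/(_ _ e20) H2 := c2.
near=> u; rewrite hprod_normE hnorm_le ?(ltW e0)//=.
have G1 : `|lim (fst @ F) - u.1| <= e / 2 by near: u.
have G2 : `|lim (snd @ F) - u.2| <= e / 2 by near: u.
have {}G1 : `|lim (fst @ F) - u.1| ^+ 2 <= (e / 2) ^+ 2.
  by rewrite ler_sqr ?nnegrE// ltW.
have {}G2 : `|lim (snd @ F) - u.2| ^+ 2 <= (e / 2) ^+ 2.
  by rewrite ler_sqr ?nnegrE// ltW.
apply: le_trans (lerD G1 G2) _.
exact: half_sum.
Unshelve. all: by end_near. Qed.

HB.instance Definition _ := Uniform_isComplete.Build XK hprod_cauchy_cvg.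

Let hinnerC u v : hinner u v = hinner v u.
Proof. by rewrite /hinner innerC [X in _ + X]innerC. Qed.

Let hinnerPl (a : R) u v w :
  hinner (a *: u + v) w = a * hinner u w + hinner v w.
Proof. by rewrite /hinner/= !innerPl; ring. Qed.

Let hinner_sqr (u : XK) : hinner u u = `|u| ^+ 2.
Proof. by rewrite hprod_normE hnorm_sqr. Qed.

HB.instance Definition _ := @CompleteNormedModule_isHilbert.Build R XK
  hinner hinnerC hinnerPl hinner_sqr.

End hprod_hilbert.

Lemma hprod_innerE (R : realType) (X K : hilbertType R) (u v : hprod X K) :
  inner u v = inner u.1 v.1 + inner u.2 v.2.
Proof. by []. Qed.

Section convex_analysis.
Context (R : realType).
Implicit Types H X K : hilbertType R.

(* With the library convention 0 * +oo = 0 and values in ]-oo, +oo], the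
   endpoints t = 0 and t = 1 impose nothing. *)
Definition econvex H (f : H -> \bar R) := forall (t : R) (x y : H),
  0 <= t <= 1 ->
  (f (t *: x + (1 - t) *: y)%R <= t%:E * f x + (1 - t)%:E * f y)%E.

Definition gamma0 H (f : H -> \bar R) :=
  [/\ forall x, f x != -oo%E, exists x, (f x < +oo)%E,
      lower_semicontinuous f & econvex f].

Definition edom H (f : H -> \bar R) : set H := [set x | (f x < +oo)%E].

Definition argmin T (C : set T) (F : T -> \bar R) : set T :=
  [set x | C x /\ forall y, C y -> (F x <= F y)%E].

(* [prox], [adjoint], [opinv] and [gradient] select the point with the defining
   property, which is unique whenever it exists in the intended cases, and
   return 0 when there is none. *)
Definition prox H (f : H -> \bar R) (x : H) : H :=
  xget 0 (argmin setT (fun y => f y + (2^-1 * `|x - y| ^+ 2)%:E)%E).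

Definition lspan H (S : set H) : set H :=
  [set x | exists (n : nat) (c : 'I_n -> R) (v : 'I_n -> H),
     (forall i, S (v i)) /\ x = \sum_(i < n) c i *: v i].

Definition finite_dim H :=
  exists (n : nat) (e : 'I_n -> H), lspan (range e) = setT.

Definition cone H (S : set H) : set H :=
  [set x | exists (l : R) (s : H), [/\ 0 < l, S s & x = l *: s]].

Definition sri H (C : set H) : set H :=
  [set x | C x /\
     cone [set y - x | y in C] = closure (lspan [set y - x | y in C])].

Definition bounded_operator X K (A : X -> K) :=
  exists M : R, forall x, `|A x| <= M * `|x|.

Definition adjoint X K (A : X -> K) (y : K) : X :=
  xget 0 [set x' | forall x, inner (A x) y = inner x x'].

Definition opinv H (B : H -> H) (y : H) : H := xget 0 [set x | B x = y].

Definition is_gradient H (F : H -> R) (x g : H) :=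
  forall h : H, is_derive x h (F : H -> R^o) (inner g h).

Definition gateaux_differentiable H (F : H -> R) :=
  forall x, exists g, is_gradient F x g.

Definition gradient H (F : H -> R) (x : H) : H := xget 0 (is_gradient F x).

Definition Fix T (N : T -> T) : set T := [set z | N z = z].

(* The infimum is attained when [Omega] is nonempty, closed and convex. *)
Definition dist H (Omega : set H) (x : H) : R := inf [set `|x - y| | y in Omega].

(* The sequence (u_n)_n lies in l^2_+ but not in l^1_+. *)
Definition l2_not_l1 (u : R^nat) :=
  [/\ forall n, 0 <= u n,
      cvgn (series (fun n => u n ^+ 2)) & ~ cvgn (series u)].

Definition relax H (a : R) (N : H -> H) (z : H) : H := (1 - a) *: z + a *: N z.

(* [z] is generated by the hybrid steepest descent method for minimizing
   [Theta] over [Fix N], including the requirements of the method on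
   [N] and [Theta]. *)
Definition hsdm H (N : H -> H) (Theta : H -> R) (lambda : R^nat) (z : nat -> H) :=
  [/\ 1.-lipschitz N,
      econvex (fun v => (Theta v)%:E),
      gateaux_differentiable Theta
    & forall n, z n.+1 = N (z n) - lambda n.+1 *: gradient Theta (N (z n))].

(* (I + A A^* )^{-1} *)
Definition resAA X K (A : X -> K) : K -> K :=
  opinv (fun y => y + A (adjoint A y)).

Definition Xi X K (A : X -> K) (z : hprod X K) : X :=
  z.1 - adjoint A (resAA A (A z.1 - z.2)).

Definition DRS1 X K (f : X -> \bar R) (g : K -> \bar R) (A : X -> K)
    (z : hprod X K) : hprod X K :=
  let p := z.1 - adjoint A (resAA A (A z.1 - z.2)) in
  let xh := 2 *: p - z.1 in
  let yh := 2 *: A p - z.2 in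
  (2 *: prox f xh - xh, 2 *: prox g yh - yh).

(* [xh n], [yh n] are the iterates of index n + 1/2; [xs 0] is unused. *)
Definition hsdm_DRS1 X K (f : X -> \bar R) (g : K -> \bar R) (A : X -> K)
    (Psi : X -> R) (alpha : R) (lambda : R^nat)
    (x : nat -> X) (y : nat -> K) (xh : nat -> X) (yh : nat -> K)
    (xs : nat -> X) :=
  forall n,
  [/\ (xh n, yh n) =
        (1 - alpha) *: ((x n, y n) : hprod X K)
        + alpha *: DRS1 f g A (x n, y n),
      xs n.+1 = xh n - adjoint A (resAA A (A (xh n) - yh n)),
      x n.+1 = xh n - lambda n.+1 *:
        (gradient Psi (xs n.+1)
         - adjoint A (resAA A (A (gradient Psi (xs n.+1)))))
    & y n.+1 = yh n - lambda n.+1 *: resAA A (A (gradient Psi (xs n.+1)))].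

End convex_analysis.

(* Main.v *)
Require Import Defs.
From mathcomp Require Import all_boot all_order all_algebra.
From mathcomp Require Import all_classical all_reals all_analysis.
From mathcomp Require Import ring lra.
Set Implicit Arguments.
Unset Strict Implicit.
Unset Printing Implicit Defensive.
Import Order.TTheory GRing.Theory Num.Theory.
Import numFieldNormedType.Exports.
Local Open Scope classical_set_scope.
Local Open Scope ring_scope.

(** Let P be the orthogonal projection of X * K onto the graph of A. Its first
    component is Xi, and P z = (Xi z, A (Xi z)). The operator [DRS1 f g A] is the
    reflection 2 P - I followed by the reflections of prox_f and prox_g, so it is
    nonexpansive ([DRS1_nonexpansive]): the proximity operators are resolvents of
    monotone subdifferentials. The existence of proximal points in a Hilbert
    space ([prox_argmin]) also yields the projections onto closed subspaces, the
    Riesz representation, hence adjoints, and the inverse of I + A A^*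
    ([resAAP]). The gradient of Theta = Psi o Xi is the adjoint of Xi applied to
    the gradient of Psi, and that adjoint is
    h |-> (h - A^* (I + A A^* )^{-1} A h, (I + A A^* )^{-1} A h), so the recursion
    [hsdm_DRS1] is the hybrid steepest descent iteration for Theta.

    For the convergence, z is a fixed point of [DRS1 f g A] exactly when
    z = (p + A^* nu, A p - nu), where nu is a subgradient of g at A p and - A^* nu
    one of f at p. Then p is a minimizer of f + g o A ([Fix_DRS1_argmin]), and
    conversely every minimizer p has such a nu by the qualification condition and
    the Hahn-Banach theorem ([lagrange_multiplier]). Hence Xi maps the fixed point
    set onto Sp and the minimizers of Theta over the fixed points into Omega. As
    Xi is 1-Lipschitz, it suffices to bound the distance of the iterates to the
    set Gamma of these minimizers.

    In finite dimension, let z_n be the iterates, w_n the relaxed points and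
    T = [DRS1 f g A]. For y in Gamma,
      |z_(n+1) - y|^2 <= |z_n - y|^2 - alpha (1 - alpha) |z_n - T z_n|^2
         - 2 lambda_(n+1) (Theta w_n - Theta y) + O(lambda_(n+1)^2)
    as soon as the iterates are bounded. They are ([iterates_bounded]) because
    Fix T is bounded: far away, the relaxed step decreases the distance to a fixed
    point by a fixed amount, which dominates the drift of the gradient step, and
    the remaining expansion factors 1 + O(lambda_n^2) have a bounded product. Away
    from Gamma either the residual |z_n - T z_n| or Theta w_n - Theta y is bounded
    below by a positive constant, so the squared distance to Gamma decreases at
    least at the rate of the divergent series of the lambda_n; this forces it to 0
    ([hsdm_converges]). *)

(** * Inner products and Lipschitz maps *)

Section inner_product.
Context (R : realType) (H : hilbertType R).
Implicit Types (x y z : H) (a b c : R).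

Lemma innerDl x y z : inner (x + y) z = inner x z + inner y z.
Proof. by rewrite -[x]scale1r innerPl scale1r mul1r. Qed.

Lemma inner0l z : inner 0 z = 0 :> R.
Proof. by have := innerDl 0 0 z; rewrite addr0; lra. Qed.

Lemma innerZl a x z : inner (a *: x) z = a * inner x z.
Proof. by rewrite -[a *: x]addr0 innerPl inner0l addr0. Qed.

Lemma innerNl x z : inner (- x) z = - inner x z.
Proof. by rewrite -scaleN1r innerZl mulN1r. Qed.

Lemma innerDr x y z : inner x (y + z) = inner x y + inner x z.
Proof. by rewrite !(innerC x) innerDl. Qed.

Lemma inner0r z : inner z 0 = 0 :> R.
Proof. by rewrite innerC inner0l. Qed.

Lemma innerZr a x z : inner x (a *: z) = a * inner x z.
Proof. by rewrite !(innerC x) innerZl. Qed.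

Lemma innerNr x z : inner x (- z) = - inner x z.
Proof. by rewrite !(innerC x) innerNl. Qed.

Definition innerE :=
  (innerDl, innerDr, innerNl, innerNr, innerZl, innerZr, inner0l, inner0r).

Lemma inner_suml (I : Type) (r : seq I) (P : pred I) (F : I -> H) z :
  inner (\sum_(i <- r | P i) F i) z = \sum_(i <- r | P i) inner (F i) z.
Proof.
apply: (big_morph (fun x => inner x z)); first by move=> x y; exact: innerDl.
exact: inner0l.
Qed.

Lemma inner_ge0 x : 0 <= inner x x :> R.
Proof. by rewrite inner_sqr sqr_ge0. Qed.

Lemma inner_eq0 x : inner x x = 0 :> R -> x = 0.
Proof. by move/eqP; rewrite inner_sqr sqrf_eq0 normr_eq0 => /eqP. Qed.

Lemma inner_inj x y : (forall h, inner x h = inner y h :> R) -> x = y.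
Proof.
by move=> h; apply/eqP; rewrite -subr_eq0; apply/eqP/inner_eq0;
  rewrite innerDl innerNl h subrr.
Qed.

Lemma sqr_normD x y : `|x + y| ^+ 2 = `|x| ^+ 2 + 2 * inner x y + `|y| ^+ 2.
Proof. by rewrite -!inner_sqr !innerE (innerC y x); ring. Qed.

Lemma sqr_normB x y : `|x - y| ^+ 2 = `|x| ^+ 2 - 2 * inner x y + `|y| ^+ 2.
Proof. by rewrite -!inner_sqr !innerE (innerC y x); ring. Qed.

Lemma cauchy_schwarz x y : inner x y <= `|x| * `|y|.
Proof.
suff H1 : 0 <= 2 * (`|x| * `|y|) * (`|x| * `|y| - inner x y).
  have [/eqP|xy] := eqVneq (`|x| * `|y|) 0.
    by rewrite mulf_eq0 !normr_eq0 => /orP[]/eqP->;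
      rewrite ?inner0l ?inner0r ?normr0 ?mulr0 ?mul0r.
  have xy0 : 0 < `|x| * `|y| by rewrite lt_neqAle eq_sym xy mulr_ge0.
  by move: H1; rewrite pmulr_rge0 ?subr_ge0// mulr_gt0.
have := inner_ge0 (`|y| *: x - `|x| *: y).
rewrite !innerE !inner_sqr (innerC y x); move=> /le_trans; apply.
by rewrite le_eqVlt; apply/orP; left; apply/eqP; ring.
Qed.

Lemma norm_cauchy_schwarz x y : `|inner x y| <= `|x| * `|y|.
Proof.
rewrite ler_norml cauchy_schwarz andbT lerNl -innerNl.
by apply: le_trans (cauchy_schwarz _ _) _; rewrite normrN.
Qed.

End inner_product.

Section lipschitz_maps.
Context (R : realType) (V W : normedModType R).

Lemma lipschitzP (k : R) (u : V -> W) :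
  k.-lipschitz u <-> forall x y, `|u x - u y| <= k * `|x - y|.
Proof.
split=> [h x y|h [x y] _]; last exact: h.
exact: (h (x, y)).
Qed.

Lemma lipschitz_continuous (k : R) (u : V -> W) :
  (forall x y, `|u x - u y| <= k * `|x - y|) -> continuous u.
Proof.
move=> h x; apply/cvgrPdist_le => e e0.
have k0 : 0 < `|k| + 1 by rewrite ltr_wpDl.
near=> y; apply: le_trans (h _ _) _.
apply: le_trans (_ : (`|k| + 1) * `|x - y| <= _).
  by rewrite ler_wpM2r// (le_trans (ler_norm k))// lerDl.
rewrite -ler_pdivlMl// mulrC; near: y; apply: cvgr_dist_le => //.
by rewrite divr_gt0.
Unshelve. all: by end_near. Qed.

End lipschitz_maps.

(** * Subgradients and proximity operators *)

Section subgradients.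
Context (R : realType) (H : hilbertType R).
Implicit Types (f : H -> \bar R) (p q u v : H).

Definition subgrad f p u :=
  edom f p /\ forall y, (f p + (inner u (y - p))%:E <= f y)%E.

Lemma gamma0_fin f x : gamma0 f -> edom f x -> f x = (fine (f x))%:E.
Proof.
move=> [fN _ _ _]; rewrite /edom/= => fx; rewrite fineK// fin_numE fN/=.
by move: fx; rewrite lt_neqAle => /andP[].
Qed.

Lemma econvex_fin f (t a b : R) x y : econvex f -> 0 <= t <= 1 ->
  f x = a%:E -> f y = b%:E ->
  (f (t *: x + (1 - t) *: y)%R <= (t * a + (1 - t) * b)%:E)%E.
Proof. by move=> cf t01 fx fy; have := cf t x y t01; rewrite fx fy. Qed.

Lemma subgrad_monotone f p q u v :
  gamma0 f -> subgrad f p u -> subgrad f q v ->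
  0 <= inner (u - v) (p - q).
Proof.
move=> gf [fp hp] [fq hq].
have := hp q; have := hq p.
rewrite (gamma0_fin gf fp) (gamma0_fin gf fq) -!EFinD !lee_fin.
by rewrite !innerE; lra.
Qed.

Lemma le_on_edom f (c : \bar R) x :
  (edom f x -> (c <= f x)%E) -> (c <= f x)%E.
Proof.
have [fx /(_ fx)//|] := boolP (f x < +oo)%E.
by rewrite -leNgt leye_eq => /eqP ->; rewrite leey.
Qed.

(** Lower semicontinuity bounds f below near a point of its domain, and
    convexity extends this bound along the rays issued from that point, with a
    loss that is at most linear in the distance. It follows that
    f + |x - .|^2 / 2 is bounded below. *)
Lemma gamma0_linear_bound f : gamma0 f ->
  exists (a r : R) (x1 : H), 0 < r /\
    forall y, ((a - `|y - x1| / r)%:E <= f y)%E.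
Proof.
move=> gf; have [fN [x1 x1f] lf cf] := gf.
have fx1 := gamma0_fin gf x1f; set b := fine _ in fx1.
have /lf[V nV Vf] : ((b - 1)%:E < f x1)%E by rewrite fx1 lte_fin; lra.
move/nbhs_ballP : nV => [r0 /= r0p rV].
pose r := r0 / 2; have r_gt0 : 0 < r by rewrite divr_gt0.
exists (b - 1), r, x1; split => // y.
have near1 z : `|z - x1| <= r -> ((b - 1)%:E < f z)%E.
  move=> zr; apply/Vf/rV; rewrite -ball_normE/= distrC.
  by apply: le_lt_trans zr _; rewrite /r; lra.
have d0 : 0 <= `|y - x1| / r by rewrite divr_ge0// ltW.
have [yr|yr] := leP `|y - x1| r.
  by apply: le_trans (ltW (near1 _ yr)); rewrite lee_fin; lra.
apply: le_on_edom => fy.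
have fyE := gamma0_fin gf fy; rewrite fyE lee_fin; set c := fine _ in fyE *.
pose d := `|y - x1|; have dp : 0 < d by exact: lt_trans yr.
(* the point at distance r from x1 on the segment from x1 to y *)
pose t := r / d.
have tp : 0 < t by rewrite divr_gt0.
have t1 : t <= 1 by rewrite ler_pdivrMr// mul1r ltW.
have t01 : 0 <= t <= 1 by rewrite ltW.
have := near1 (t *: y + (1 - t) *: x1).
have -> : t *: y + (1 - t) *: x1 - x1 = t *: (y - x1).
  by apply: inner_inj => h; rewrite !innerE; ring.
rewrite normrZ gtr0_norm// divfK ?gt_eqF// => /(_ (lexx _)) /lt_le_trans.
move=> /(_ _ (econvex_fin cf t01 fyE fx1)); rewrite lte_fin.
rewrite -/d -[d / r]invf_div -/t => h.
have : t * (b - t^-1) < t * c by rewrite mulrBr divff ?gt_eqF//; lra.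
by rewrite ltr_pM2l// => ?; lra.
Qed.

End subgradients.

Section proximity_operator.
Context (R : realType) (H : hilbertType R).
Implicit Types (f : H -> \bar R) (p q u v x y : H).

(** The midpoint of two points y, y' satisfies
    |x - (y + y') / 2|^2 = |x - y|^2 / 2 + |x - y'|^2 / 2 - |y - y'|^2 / 4,
    hence the sublevel sets of f + |x - .|^2 / 2 shrink to a point as the level
    decreases to the infimum: they generate a Cauchy filter, and its limit is a
    minimizer by lower semicontinuity. *)
Lemma prox_argmin f x : gamma0 f ->
  argmin setT (fun y => f y + (2^-1 * `|x - y| ^+ 2)%:E)%E (prox f x).
Proof.
move=> gf; have [fN [x1 x1f] lf cf] := gf.
pose F y := (f y + (2^-1 * `|x - y| ^+ 2)%:E)%E.
suff [p Fp] : exists p, forall y, (F p <= F y)%E.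
  by apply: xgetPex; exists p; split => // y _; exact: Fp.
have Ffin y : f y = +oo%E \/
    exists2 a, f y = a%:E & F y = (a + 2^-1 * `|x - y| ^+ 2)%:E.
  rewrite /F; have := fN y; case: (f y) => [a _|_|//]; last by left.
  by right; exists a.
pose S := [set r : R | exists y, F y = r%:E].
have S0 : S !=set0.
  case: (Ffin x1) => [fx1|[a _ Fx1]]; first by rewrite fx1 in x1f.
  by eexists; exists x1; exact: Fx1.
have Slb : has_lbound S.
  have [a [r [z [r0 h]]]] := gamma0_linear_bound gf.
  exists (a - `|x - z| / r - 2^-1 * r^-1 ^+ 2) => s [y Fy].
  case: (Ffin y) => [fy|[b fy]]; first by rewrite /F fy in Fy.
  rewrite Fy => -[->].
  have := h y; rewrite fy lee_fin.
  have : `|y - z| / r <= `|x - y| / r + `|x - z| / r.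
    rewrite -mulrDl ler_pM2r ?invr_gt0//.
    by rewrite [leRHS]addrC (distrC x y) -{1}(subrKA x) addrC ler_normD.
  have := sqr_ge0 (`|x - y| - r^-1); rewrite sqrrB.
  set d := `|x - y|; set w := `|x - z| / r; set w' := `|y - z| / r.
  move=> h1 h2 h3; move: h1; rewrite -[d * _]/(d / r); lra.
pose m := inf S.
have mF y : (m%:E <= F y)%E.
  case: (Ffin y) => [fy|[b fy Fy]]; first by rewrite /F fy leey.
  by rewrite Fy lee_fin; apply: ge_inf => //; exists y.
pose Lev e := [set y | (F y <= (m + e)%:E)%E].
have Lev0 e : 0 < e -> Lev e !=set0.
  move=> e0; have [r [y Fy] rm] := inf_adherent e0 (conj S0 Slb).
  by exists y; rewrite /Lev/= Fy lee_fin ltW.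
have Levd e y y' : Lev e y -> Lev e y' -> `|y - y'| ^+ 2 <= 8 * e.
  rewrite /Lev/= => Ly Ly'.
  case: (Ffin y) Ly => [fy|[b fy ->]]; first by rewrite /F fy.
  case: (Ffin y') Ly' => [fy'|[b' fy' ->]]; first by rewrite /F fy'.
  rewrite !lee_fin => Ly' Ly.
  have t01 : 0 <= (2^-1 : R) <= 1 by apply/andP; split; lra.
  have := econvex_fin cf t01 fy fy'; set z := _ *: y + _.
  case: (Ffin z) => [->//|[c fz Fz]]; rewrite fz lee_fin.
  have := mF z; rewrite Fz lee_fin.
  have -> : `|x - z| ^+ 2 =
      2^-1 * `|x - y| ^+ 2 + 2^-1 * `|x - y'| ^+ 2 - 4^-1 * `|y - y'| ^+ 2.
    rewrite /z -!inner_sqr !innerE (innerC y x) (innerC y' x) (innerC y' y).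
    by field.
  move: Ly Ly'; set A := `|x - y| ^+ 2; set B := `|x - y'| ^+ 2.
  by set C := `|y - y'| ^+ 2; lra.
pose Fl := filter_from [set e : R | 0 < e] Lev.
have FlF : ProperFilter Fl.
  apply: filter_from_proper; last by move=> e /= /Lev0.
  apply: filter_from_filter; first by exists 1 => /=.
  move=> i j /= i0 j0; exists (Num.min i j) => /=; first by rewrite lt_min i0.
  move=> y Ly; split; apply: le_trans Ly _; rewrite lee_fin lerD2l ge_min lexx//.
  by rewrite orbT.
have /cauchy_cvgP Flcvg : cauchy Fl.
  apply: cauchy_exP => e e0.
  have e'0 : 0 < e ^+ 2 / 16 by rewrite divr_gt0// exprn_gt0.
  have [y Ly] := Lev0 _ e'0; exists y; exists (e ^+ 2 / 16) => // y' Ly'.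
  rewrite -ball_normE/= -ltr_sqr ?nnegrE ?(ltW e0)//.
  apply: le_lt_trans (Levd _ _ _ Ly Ly') _.
  by have := exprn_gt0 2 e0; lra.
exists (lim Fl) => y; apply: le_trans (mF y).
set p := lim Fl in Flcvg *.
rewrite leNgt; apply/negP => mp.
have [c mc cp] : exists2 c, m - 2^-1 * `|x - p| ^+ 2 < c & (c%:E < f p)%E.
  case: (Ffin p) => [->|[b fp Fp]].
    by exists (m - 2^-1 * `|x - p| ^+ 2 + 1); [lra|rewrite ltry].
  move: mp; rewrite Fp lte_fin => mp.
  exists ((m - 2^-1 * `|x - p| ^+ 2 + b) / 2); last rewrite fp lte_fin; lra.
pose eta := (c - (m - 2^-1 * `|x - p| ^+ 2)) / 2.
have eta0 : 0 < eta by rewrite /eta; lra.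
have [V pV Vc] := lf _ _ cp.
have normc : 2^-1 * `|x - z| ^+ 2 @[z --> p] --> 2^-1 * `|x - p| ^+ 2.
  apply: cvgM; first exact: cvg_cst.
  apply: (@cvg_comp _ _ _ (fun z => `|x - z|) (fun a => a ^+ 2)
    _ (nbhs `|x - p|)).
    by apply: cvg_norm; apply: cvgB; [exact: cvg_cst|exact: cvg_id].
  exact: exprn_continuous.
have W : \forall z \near p, 2^-1 * `|x - p| ^+ 2 - eta < 2^-1 * `|x - z| ^+ 2.
  by apply: cvgr_gt normc _ _; lra.
have FV : Fl V by exact: (Flcvg V pV).
have FW := Flcvg _ W.
have FL : Fl (Lev eta) by exists eta.
have [z [[Vz Wz]]] := filter_ex (filterI (filterI FV FW) FL).
move: Wz => /=; rewrite /Lev/=; have := Vc z Vz.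
case: (Ffin z) => [fz _ _|[b fz ->]]; first by rewrite /F fz.
by rewrite fz lte_fin lee_fin /eta; lra.
Qed.

(** Fermat's rule for f + |x - .|^2 / 2, the quadratic part being differentiated
    by hand along segments. *)
Lemma prox_subgrad f x : gamma0 f -> subgrad f (prox f x) (x - prox f x).
Proof.
move=> gf; have [fN [x1 x1f] lf cf] := gf.
have [_ hp] := prox_argmin x gf; set p := prox f x in hp *.
have fp : edom f p.
  have := hp x1 I; move: x1f; rewrite /edom/=.
  case: (f p) (fN p) => [r _|_|//]; first by rewrite ltry.
  by case: (f x1) => [r _|//|//].
split=> // y; apply: le_on_edom => fy.
have fpE := gamma0_fin gf fp; set a := fine _ in fpE.
have fyE := gamma0_fin gf fy; set b := fine _ in fyE.
rewrite fpE fyE -EFinD lee_fin.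
(* moving from p towards y by a fraction t and letting t tend to 0 *)
have key t : 0 < t -> t <= 1 ->
    t * (a + inner (x - p) (y - p) - b) <= t * (2^-1 * t * `|y - p| ^+ 2).
  move=> t0 t1; have t01 : 0 <= t <= 1 by rewrite ltW.
  pose z := t *: y + (1 - t) *: p.
  have := econvex_fin cf t01 fyE fpE; have := hp z I; rewrite -/z.
  have := fN z; case: (f z) => [c _|//|//]; rewrite fpE -!EFinD !lee_fin.
  have -> : `|x - z| ^+ 2 =
      `|x - p| ^+ 2 - 2 * t * inner (x - p) (y - p) + t ^+ 2 * `|y - p| ^+ 2.
    rewrite /z -!inner_sqr !innerE (innerC y x) (innerC p x) (innerC y p); ring.
  by set u := `|x - p| ^+ 2; set v := `|y - p| ^+ 2; set w := inner _ _; lra.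
rewrite -subr_le0 leNgt; apply/negP => h.
set d := a + _ - b in key h; pose n := `|y - p| ^+ 2.
have n0 : 0 <= n by rewrite /n sqr_ge0.
pose t := Num.min 1 (d / (n + 1)).
have t0 : 0 < t by rewrite lt_min ltr01 divr_gt0// ltr_wpDl.
have t1 : t <= 1 by rewrite ge_min lexx.
have := key t t0 t1; rewrite ler_pM2l// -/n leNgt => /negP; apply.
have : t * (n + 1) <= d by rewrite -ler_pdivlMr ?ltr_wpDl// ge_min lexx orbT.
by have := mulr_ge0 (ltW t0) n0; lra.
Qed.

Lemma subgrad_prox f p u : gamma0 f -> subgrad f p u -> prox f (p + u) = p.
Proof.
move=> gf su; have := subgrad_monotone gf su (prox_subgrad (p + u) gf).
set q := prox _ _ => h; apply/eqP; rewrite eq_sym -subr_eq0; apply/eqP/inner_eq0.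
apply/eqP; rewrite eq_le inner_ge0 andbT.
have -> : inner (p - q) (p - q) = - inner (u - (p + u - q)) (p - q).
  by rewrite !innerE; ring.
by rewrite oppr_le0.
Qed.

(** The subdifferential contains every pair (prox_f x, x - prox_f x), and its
    monotonicity is the claim once the squared norms are expanded. *)
Lemma reflected_prox_nonexpansive f x y : gamma0 f ->
  `|(2 *: prox f x - x) - (2 *: prox f y - y)| ^+ 2 <= `|x - y| ^+ 2.
Proof.
move=> gf.
have := subgrad_monotone gf (prox_subgrad x gf) (prox_subgrad y gf).
set p := prox f x; set q := prox f y.
have -> : `|(2 *: p - x) - (2 *: q - y)| ^+ 2 =
   `|x - y| ^+ 2 - 4 * inner (x - p - (y - q)) (p - q).
  rewrite -!inner_sqr !innerE.
  rewrite (innerC p x) (innerC q x) (innerC y x).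
  rewrite (innerC q p) (innerC y p) (innerC y q).
  by ring.
by lra.
Qed.

End proximity_operator.

(** * Projections onto subspaces and Riesz representation *)

Section projection_and_riesz.
Context (R : realType) (H : hilbertType R).
Implicit Types (V : set H) (x y p v h : H).

Lemma gamma0_EFin (u : H -> R) : continuous u ->
  (forall (t : R) x y, 0 <= t <= 1 ->
     u (t *: x + (1 - t) *: y) <= t * u x + (1 - t) * u y) ->
  gamma0 (fun x => (u x)%:E).
Proof.
move=> cu convu; split=> [x||x a|t x y t01]; first by [].
- by exists 0; rewrite ltry.
- rewrite lte_fin => ax.
  exists [set y | a < u y]; last by move=> y; rewrite lte_fin.
  exact: (cvgr_gt (u x) (cu x) a ax).
- by rewrite -!EFinM -EFinD lee_fin convu.
Qed.

Definition subspace V := V 0 /\ forall (a : R) x y, V x -> V y -> V (a *: x + y).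

Lemma gamma0_indicator V : closed V -> subspace V ->
  gamma0 (fun y => if `[< V y >] then 0%E else +oo%E : \bar R).
Proof.
move=> cV [V0 VL].
have VZ (a : R) x : V x -> V (a *: x) by rewrite -[a *: x]addr0 => Vx; exact: VL.
split=> [x||x a|t x y /andP[t0 t1]].
- by case: ifP.
- by exists 0; case: asboolP.
- case: asboolP => [Vx a0|nVx _].
    exists setT => [|y _]; first exact: filterT.
    by case: asboolP => // _; rewrite ltry.
  exists (~` V); last by move=> y nVy; case: asboolP => // _; rewrite ltry.
  by apply: open_nbhs_nbhs; split => //; exact: closed_openC.
- have nn (s : R) z : 0 <= s -> (0 <= s%:E * (if `[<V z>] then 0 else +oo))%E.
    by move=> s0; apply: mule_ge0; [rewrite lee_fin|case: ifP].
  have t1' : 0 <= 1 - t by rewrite subr_ge0.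
  case: (asboolP (V (_ + _))) => [_|nV]; first by rewrite adde_ge0 ?nn.
  have [t_eq0|tn0] := eqVneq t 0.
    move: nV; rewrite t_eq0 scale0r subr0 scale1r add0r mul0e mul1e add0e => nV.
    by rewrite asboolF.
  have [t_eq1|tn1] := eqVneq t 1.
    move: nV; rewrite t_eq1 subrr scale0r scale1r addr0 mul0e mul1e adde0 => nV.
    by rewrite asboolF.
  have tp : 0 < t by rewrite lt_neqAle eq_sym tn0.
  have tp' : 0 < 1 - t by rewrite subr_gt0 lt_neqAle tn1.
  have [Vx|nVx] := pselect (V x); last first.
    rewrite (asboolF nVx) gt0_muley ?lte_fin// addye// gt_eqF//.
    by rewrite (lt_le_trans _ (nn _ y t1'))// ltNyr.
  rewrite (asboolF (P := V y)) ?gt0_muley ?lte_fin ?addey//.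
    by rewrite gt_eqF// (lt_le_trans _ (nn _ x t0))// ltNyr.
  by move=> Vy; apply: nV; apply: VL => //; exact: VZ.
Qed.

(** The proximity operator of the indicator function of V provides the
    projection, since the subgradients of that function at a point of V are
    orthogonal to V. *)
Lemma orthogonal_projection V h : closed V -> subspace V ->
  exists p, V p /\ forall v, V v -> inner (h - p) v = 0 :> R.
Proof.
move=> cV sV; have [V0 VL] := sV.
have [] := prox_subgrad h (gamma0_indicator cV sV); set p := prox _ h.
rewrite /edom/=; case: asboolP => // Vp _ hp; exists p; split => // v Vv.
have key (a : R) : a * inner (h - p) v <= 0.
  have := hp (a *: v + p); rewrite asboolT; last exact: VL.
  by rewrite addrK add0e lee_fin innerZr.
by have := key 1; have := key (-1); lra.
Qed.

(** Riesz: the minimizer p of |x|^2 / 2 - phi x satisfies the optimality condition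
    phi v = <v, p>. *)
Lemma riesz_representation (phi : H -> R) (M : R) :
  (forall (a : R) x y, phi (a *: x + y) = a * phi x + phi y) ->
  (forall x, `|phi x| <= M * `|x|) -> exists p, forall v, phi v = inner v p.
Proof.
move=> phiP bphi.
have phi0 : phi 0 = 0 by have := phiP 1 0 0; rewrite scaler0 addr0; lra.
have phiZ a x : phi (a *: x) = a * phi x.
  by rewrite -[a *: x]addr0 phiP phi0 addr0.
have gphi : gamma0 (fun x => (- phi x)%:E).
  apply: gamma0_EFin => [|t x y _]; last by rewrite phiP phiZ; lra.
  apply: (@lipschitz_continuous _ _ R^o M) => x y.
  rewrite -opprD normrN; have -> : phi x - phi y = phi (x - y); last exact: bphi.
  by rewrite [x - y]addrC -(scaleN1r y) phiP mulN1r addrC.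
have [_ hp] := prox_subgrad 0 gphi; set p := prox _ 0 in hp *.
exists p => v.
have key (a : R) : a * (phi v - inner v p) <= 0.
  have := hp (a *: v + p); rewrite addrK -EFinD lee_fin phiP sub0r innerNl.
  by rewrite innerZr (innerC p); lra.
by have := key 1; have := key (-1); lra.
Qed.

End projection_and_riesz.

(** * The projection onto the graph of A *)

Lemma hprod_sqr_norm (R : realType) (X K : hilbertType R) (u : hprod X K) :
  `|u| ^+ 2 = `|u.1| ^+ 2 + `|u.2| ^+ 2.
Proof. by rewrite -!inner_sqr hprod_innerE. Qed.

Lemma hprod_norm1_le (R : realType) (X K : hilbertType R) (u : hprod X K) :
  `|u.1| <= `|u|.
Proof. by rewrite -ler_sqr ?nnegrE// hprod_sqr_norm lerDl sqr_ge0. Qed.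

Lemma hprod_norm2_le (R : realType) (X K : hilbertType R) (u : hprod X K) :
  `|u.2| <= `|u|.
Proof. by rewrite -ler_sqr ?nnegrE// hprod_sqr_norm lerDr sqr_ge0. Qed.

Section graph_projection.
Context (R : realType) (X K : hilbertType R) (A : {linear X -> K}).
Hypothesis bA : bounded_operator A.
Notation A' := (adjoint A).
Implicit Types (x : X) (y : K) (z w : hprod X K).

Lemma adjointP x y : inner (A x) y = inner x (A' y) :> R.
Proof.
have [M hM] := bA.
have [p hp] : exists p, forall v, inner (A v) y = inner v p.
  apply: (riesz_representation (M := M * `|y|)) => [a u v|u].
    by rewrite linearP innerDl innerZl.
  apply: le_trans (norm_cauchy_schwarz _ _) _.
  by rewrite mulrAC ler_wpM2r.
suff : [set x' | forall x, inner (A x) y = inner x x' :> R] (A' y) by apply.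
by apply: xgetPex; exists p => u; exact: (hp u).
Qed.

Lemma adjoint_linear : linear (A' : K -> X).
Proof.
move=> a u v; apply: inner_inj => h.
by rewrite innerC -adjointP !innerE (innerC (A' u)) (innerC (A' v)) -!adjointP.
Qed.

Lemma IAA_inj y : y + A (A' y) = 0 -> y = 0.
Proof.
move=> h; apply: inner_eq0.
have : inner (y + A (A' y)) y = 0 :> R by rewrite h inner0l.
rewrite innerDl adjointP.
by have := inner_ge0 (A' y); have := inner_ge0 y; lra.
Qed.

(** Projecting (0, -y) onto the graph of A produces a point (p, A p) with
    p = - A^* (A p + y), so that A p + y solves (I + A A^* ) nu = y. *)
Lemma resAAP y : resAA A y + A (A' (resAA A y)) = y.
Proof.
suff [nu hnu] : exists nu, nu + A (A' nu) = y.
  suff : [set nu | nu + A (A' nu) = y] (resAA A y) by [].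
  by apply: xgetPex; exists nu.
have [M hM] := bA.
pose V := [set z : hprod X K | z.2 - A z.1 = 0].
have cV : closed V.
  have -> : V = (fun z : hprod X K => z.2 - A z.1) @^-1` [set 0] by [].
  apply: closed_comp; last first.
    exact/accessible_closed_set1/hausdorff_accessible/norm_hausdorff.
  move=> z _; apply: (@lipschitz_continuous _ _ _ (1 + `|M|)) => {}z w.
  have -> : z.2 - A z.1 - (w.2 - A w.1) = (z - w).2 - A (z - w).1.
    rewrite -[(z - w).1]/(z.1 - w.1) -[(z - w).2]/(z.2 - w.2) (linearB A).
    by apply: inner_inj => h; rewrite !innerE; ring.
  apply: le_trans (ler_normB _ _) _; rewrite mulrDl mul1r lerD ?hprod_norm2_le//.
  apply: le_trans (hM _) _; apply: le_trans (_ : `|M| * `|(z - w).1| <= _).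
    by rewrite ler_wpM2r// ler_norm.
  by rewrite ler_wpM2l// hprod_norm1_le.
have sV : subspace V.
  split=> [|a z w]; first by change (0 - A 0 = 0); rewrite linear0 subr0.
  move=> /eqP; rewrite subr_eq0 => /eqP zE /eqP; rewrite subr_eq0 => /eqP wE.
  change (a *: z.2 + w.2 - A (a *: z.1 + w.1) = 0).
  by rewrite linearP zE wE subrr.
have [p [Vp hp]] := orthogonal_projection ((0, - y) : hprod X K) cV sV.
have {}Vp : p.2 = A p.1 by apply/eqP; rewrite -subr_eq0; apply/eqP.
exists (A p.1 + y).
have -> : A' (A p.1 + y) = - p.1.
  apply: inner_inj => h; rewrite innerC -adjointP.
  have := hp (h, A h); rewrite /V/= subrr => /(_ erefl).
  rewrite hprod_innerE/= Vp sub0r !innerE.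
  rewrite (innerC p.1) (innerC (A h)) [inner (A h) y]innerC.
  by lra.
by rewrite linearN addrAC subrr add0r.
Qed.

Lemma adjointB u v : A' (u - v) = A' u - A' v.
Proof. by rewrite addrC -scaleN1r adjoint_linear scaleN1r addrC. Qed.

Lemma resAA_uniq y nu : nu + A (A' nu) = y -> resAA A y = nu.
Proof.
move=> h; apply/eqP; rewrite -subr_eq0; apply/eqP/IAA_inj.
by rewrite adjointB linearB addrACA resAAP -opprD h subrr.
Qed.

Lemma resAA_linear : linear (resAA A : K -> K).
Proof.
move=> a u v; apply: resAA_uniq.
by rewrite adjoint_linear linearP addrACA -scalerDr !resAAP.
Qed.

Lemma resAA_sym u v : inner (resAA A u) v = inner u (resAA A v) :> R.
Proof.
rewrite -[in LHS](resAAP v) -[in RHS](resAAP u).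
rewrite innerDr innerDl (innerC (resAA A u) (A _)) !adjointP.
by rewrite (innerC (A' (resAA A v))).
Qed.

Definition multiplier z : K := resAA A (A z.1 - z.2).

Lemma multiplier_linear : linear (multiplier : hprod X K -> K).
Proof.
move=> a z w; rewrite /multiplier -resAA_linear; congr (resAA A _).
change (A (a *: z.1 + w.1) - (a *: z.2 + w.2) =
  a *: (A z.1 - z.2) + (A w.1 - w.2)).
by rewrite linearP; apply: inner_inj => h; rewrite !innerE; ring.
Qed.

(** With [Xi_dec2], this splits z into its projection (p, A p) on the graph of A
    and the part (A^* nu, - nu), which is orthogonal to the graph. *)
Lemma Xi_dec1 z : z.1 = Xi A z + A' (multiplier z).
Proof. by rewrite subrK. Qed.

Lemma Xi_dec2 z : z.2 = A (Xi A z) - multiplier z.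
Proof.
rewrite /Xi linearB -/(multiplier z) -addrA -opprD addrC [A _ + _]addrC.
by rewrite resAAP opprB addrNK.
Qed.

Lemma Xi_linear : linear (Xi A : hprod X K -> X).
Proof.
move=> a z w; rewrite /Xi -!/(multiplier _) multiplier_linear adjoint_linear.
change (a *: z.1 + w.1 - (a *: A' (multiplier z) + A' (multiplier w)) =
  a *: (z.1 - A' (multiplier z)) + (w.1 - A' (multiplier w))).
by rewrite opprD addrACA -scalerBr.
Qed.

Lemma XiB z w : Xi A (z - w) = Xi A z - Xi A w.
Proof. by rewrite addrC -scaleN1r Xi_linear scaleN1r addrC. Qed.

Lemma Xi_norm_le z : `|Xi A z| <= `|z|.
Proof.
rewrite -ler_sqr ?nnegrE// hprod_sqr_norm.
rewrite [in leRHS]Xi_dec1 [in X in _ + `|X| ^+ 2]Xi_dec2.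
move: (Xi A z) (multiplier z) => p nu; rewrite sqr_normD sqr_normB -adjointP.
have := sqr_ge0 `|A p|; have := sqr_ge0 `|A' nu|; have := sqr_ge0 `|nu|.
by lra.
Qed.

Definition graph_reflection z : hprod X K :=
  (2 *: Xi A z - z.1, 2 *: A (Xi A z) - z.2).

(** The reflection maps (p + A^* nu, A p - nu) to (p - A^* nu, A p + nu), and the
    cross terms <p, A^* nu> and <A p, nu> cancel. *)
Lemma graph_reflection_isometry z : `|graph_reflection z| ^+ 2 = `|z| ^+ 2.
Proof.
rewrite !hprod_sqr_norm/=.
have -> : 2 *: Xi A z - z.1 = Xi A z - A' (multiplier z).
  by rewrite [in LHS](Xi_dec1 z) scaler_nat mulr2n opprD addrACA subrr add0r.
have -> : 2 *: A (Xi A z) - z.2 = A (Xi A z) + multiplier z.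
  by rewrite [in LHS](Xi_dec2 z) scaler_nat mulr2n opprB addrACA subrr addr0.
rewrite [in RHS]Xi_dec1 [in X in _ = _ + `|X| ^+ 2]Xi_dec2.
move: (Xi A z) (multiplier z) => p nu.
by rewrite !sqr_normD !normrN !innerNr -!adjointP; ring.
Qed.

Lemma graph_reflectionB z w :
  graph_reflection z - graph_reflection w = graph_reflection (z - w).
Proof.
rewrite /graph_reflection XiB.
change ((2 *: Xi A z - z.1 - (2 *: Xi A w - w.1),
  2 *: A (Xi A z) - z.2 - (2 *: A (Xi A w) - w.2)) =
  (2 *: (Xi A z - Xi A w) - (z.1 - w.1),
   2 *: A (Xi A z - Xi A w) - (z.2 - w.2))).
by congr pair; rewrite ?linearB; apply: inner_inj => h; rewrite !innerE; ring.
Qed.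

(** [DRS1] is the reflection through the graph of A followed by the reflections
    2 prox_f - I and 2 prox_g - I, applied componentwise. *)
Lemma DRS1_nonexpansive (f : X -> \bar R) (g : K -> \bar R) :
  gamma0 f -> gamma0 g ->
  forall z w, `|DRS1 f g A z - DRS1 f g A w| <= `|z - w|.
Proof.
move=> gf gg z w; rewrite -ler_sqr ?nnegrE// -(graph_reflection_isometry (z - w)).
rewrite -graph_reflectionB !hprod_sqr_norm.
have h1 := reflected_prox_nonexpansive
  (graph_reflection z).1 (graph_reflection w).1 gf.
have h2 := reflected_prox_nonexpansive
  (graph_reflection z).2 (graph_reflection w).2 gg.
exact: lerD h1 h2.
Qed.

Definition Xi_adjoint (h : X) : hprod X K :=
  (h - A' (resAA A (A h)), resAA A (A h)).

Lemma Xi_adjointP h z : inner (Xi_adjoint h) z = inner h (Xi A z) :> R.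
Proof.
rewrite hprod_innerE/= innerDl innerNl (innerC (A' _)) -adjointP.
rewrite /Xi innerDr innerNr -adjointP -(resAA_sym (A h)) innerDr innerNr.
by rewrite (innerC (A z.1)); ring.
Qed.

End graph_projection.

(** * Gradients of convex functions *)

Section gradients.
Context (R : realType).

Lemma is_gradient_uniq (H : hilbertType R) (F : H -> R) x g :
  is_gradient F x g -> gradient F x = g.
Proof.
move=> hg; apply: inner_inj => h.
have hg' : is_gradient F x (gradient F x) by apply: xgetPex; exists g.
by rewrite -(derive_val (is_derive := hg h)) -(derive_val (is_derive := hg' h)).
Qed.

Lemma gradientP (H : hilbertType R) (F : H -> R) x :
  gateaux_differentiable F -> is_gradient F x (gradient F x).
Proof. by move=> dF; apply: xgetPex; exact: dF. Qed.

Lemma is_gradient_comp_Xi (X K : hilbertType R) (A : {linear X -> K})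
    (F : X -> R) z g : bounded_operator A ->
  is_gradient F (Xi A z) g -> is_gradient (F \o Xi A) z (Xi_adjoint A g).
Proof.
move=> bA hg h; rewrite (Xi_adjointP bA).
have E : (fun t : R => t^-1 *:
      (((F \o Xi A) \o shift z) (t *: h) - (F \o Xi A) z) : R^o)
    = (fun t => t^-1 *: ((F \o shift (Xi A z)) (t *: Xi A h) - F (Xi A z))).
  by apply/funext => t /=; rewrite (Xi_linear bA).
have [dF vF] := hg (Xi A h).
split; first by rewrite /derivable E.
by rewrite /derive E.
Qed.

Lemma gradient_comp_Xi (X K : hilbertType R) (A : {linear X -> K})
    (F : X -> R) z : bounded_operator A -> gateaux_differentiable F ->
  gradient (F \o Xi A) z = Xi_adjoint A (gradient F (Xi A z)).
Proof.
move=> bA dF; apply: is_gradient_uniq; apply: is_gradient_comp_Xi => //.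
exact: gradientP.
Qed.

End gradients.

Section convex_gradient.
Context (R : realType) (H : hilbertType R).
Implicit Types (F : H -> R) (x y : H).

(** Convexity bounds the difference quotients from x towards y by F y - F x. *)
Lemma convex_gradient_le F x g y : econvex (fun v => (F v)%:E) ->
  is_gradient F x g -> F x + inner g (y - x) <= F y.
Proof.
move=> cF /(_ (y - x)) [dF vF]; rewrite leNgt; apply/negP => lt.
have : ((fun t : R => t^-1 *: ((F \o shift x) (t *: (y - x)) - F x) : R^o) @ 0^')
    --> (inner g (y - x) : R^o) by rewrite -vF; exact: dF.
have lt' : F y - F x < inner g (y - x) by lra.
move=> /cvgr_gt/(_ _ lt').
move=> [e /= e0 he].
pose t := Num.min 1 (e / 2).
have t0 : 0 < t by rewrite lt_min ltr01 divr_gt0.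
have t1 : t <= 1 by rewrite ge_min lexx.
have te : t < e.
  by apply: le_lt_trans (_ : t <= e / 2) _; rewrite ?ge_min ?lexx ?orbT//; lra.
have := he t; rewrite /ball_/= sub0r normrN gtr0_norm// => /(_ te).
rewrite gt_eqF// => /(_ isT).
have -> : t *: (y - x) + x = t *: y + (1 - t) *: x.
  by apply: inner_inj => h; rewrite !innerE; ring.
have := cF t y x; rewrite (ltW t0) t1 => /(_ isT); rewrite -!EFinM -EFinD lee_fin.
move=> h; rewrite ltNge => /negP; apply.
rewrite [_ *: _](_ : _ = t^-1 * (F (t *: y + (1 - t) *: x) - F x))//.
by rewrite ler_pdivrMl//; lra.
Qed.

Lemma continuous_of_gradient F (G : H -> H) (L : R) :
  (forall x y, F x + inner (G x) (y - x) <= F y) ->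
  (forall x y, `|G x - G y| <= L * `|x - y|) -> continuous F.
Proof.
move=> hG LG x; apply/cvgrPdist_le => e e0.
pose C := `|G x| + `|L|.
have C0 : 0 < C + 1 by rewrite ltr_wpDl// addr_ge0.
near=> y.
have xy1 : `|x - y| <= 1 by near: y; apply: cvgr_dist_le => //; exact: ltr01.
have xye : `|x - y| <= e / (C + 1).
  by near: y; apply: cvgr_dist_le => //; rewrite divr_gt0.
have Gy : `|G y| <= C.
  have : `|G y| <= `|G x| + `|G x - G y|.
    by rewrite (distrC (G x)) -{1}(subrKC (G x) (G y)) ler_normD.
  have := LG x y; have := ler_wpM2r (normr_ge0 (x - y)) (ler_norm L).
  have := ler_wpM2l (normr_ge0 L) xy1.
  by rewrite /C mulr1; lra.
have Gx : `|G x| <= C by rewrite /C lerDl.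
have h1 : F x - F y <= C * `|x - y|.
  have := hG x y; have := ler_norm (inner (G x) (y - x)).
  have := norm_cauchy_schwarz (G x) (y - x); rewrite (distrC y).
  have := ler_wpM2r (normr_ge0 (x - y)) Gx.
  have := ler_norm (- inner (G x) (y - x)).
  by rewrite normrN; lra.
have h2 : F y - F x <= C * `|x - y|.
  have := hG y x; have := norm_cauchy_schwarz (G y) (x - y).
  have := ler_wpM2r (normr_ge0 (x - y)) Gy.
  have := ler_norm (- inner (G y) (x - y)).
  by rewrite normrN; lra.
apply: le_trans (_ : C * `|x - y| <= _).
  by rewrite ler_norml h1 lerNl opprB h2.
by move: xye; rewrite ler_pdivlMr//; have := normr_ge0 (x - y); lra.
Unshelve. all: by end_near. Qed.

End convex_gradient.

Section composed_objective.
Context (R : realType) (X K : hilbertType R) (A : {linear X -> K}).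
Hypothesis bA : bounded_operator A.

Lemma Xi_adjoint_lipschitz h h' :
  `|Xi_adjoint A h - Xi_adjoint A h'| <= `|h - h'|.
Proof.
have -> : Xi_adjoint A h - Xi_adjoint A h' = Xi_adjoint A (h - h').
  apply: inner_inj => u.
  by rewrite innerDl innerNl !(Xi_adjointP bA) innerDl innerNl.
set u := Xi_adjoint A _.
have : `|u| * `|u| <= `|h - h'| * `|u|.
  rewrite -expr2 -inner_sqr {1}/u (Xi_adjointP bA).
  apply: le_trans (cauchy_schwarz _ _) _; rewrite ler_wpM2l//.
  exact: Xi_norm_le.
have [->|u0] := eqVneq u 0; first by rewrite normr0.
by rewrite ler_pM2r// normr_gt0.
Qed.

Lemma econvex_comp_Xi (Psi : X -> R) : econvex (fun x => (Psi x)%:E) ->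
  econvex (fun z => ((Psi \o Xi A) z)%:E).
Proof.
move=> cPsi t z w t01 /=.
have -> : Xi A (t *: z + (1 - t) *: w) = t *: Xi A z + (1 - t) *: Xi A w.
  have Xi0 : Xi A 0 = 0 by have := XiB bA 0 0; rewrite !subrr.
  by rewrite (Xi_linear bA) -[(1 - t) *: w]addr0 (Xi_linear bA) Xi0 addr0.
exact: cPsi.
Qed.

End composed_objective.

(** * Finite-dimensional spaces *)

Section finite_dimension.
Context (R : realType) (H : hilbertType R).
Implicit Types (x y u : H) (s t : seq H).

(** The coordinates of x along the entries of t, put together again. When t is
    orthonormal this is the projection onto its span, and finite dimension is
    used below in the form: [expand t] is the identity for some t. Such a t need
    be neither free nor orthonormal, so the property passes to images under
    coordinate projections. *)
Definition expand t x : H := \sum_(u <- t) inner x u *: u.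

Lemma expand_linear t : linear (expand t).
Proof.
move=> a x y; rewrite /expand scaler_sumr -big_split/=; apply: eq_bigr => u _.
by rewrite innerDl innerZl scalerDl scalerA.
Qed.

Lemma expand0 t : expand t 0 = 0.
Proof. by rewrite /expand big1// => u _; rewrite inner0l scale0r. Qed.

Lemma expand_sym t x y : inner (expand t x) y = inner x (expand t y) :> R.
Proof.
rewrite [RHS]innerC /expand !inner_suml; apply: eq_bigr => u _.
by rewrite !innerZl (innerC u x) (innerC u y) mulrC.
Qed.

(** Gram-Schmidt. Orthonormality of t is only kept as: [expand t] fixes the
    entries of t, which makes it a self-adjoint idempotent. *)
Lemma gram_schmidt s : exists t,
  (forall u, u \in t -> expand t u = u) /\ forall x, x \in s -> expand t x = x.
Proof.
elim: s => [|x s [t [tt ts]]]; first by exists [::].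
pose r := x - expand t x.
have [r0|r0] := eqVneq r 0.
  exists t; split=> // y; rewrite inE => /orP[/eqP ->|/ts//].
  by move/eqP: r0; rewrite subr_eq0 eq_sym => /eqP.
have Er : expand t r = 0.
  rewrite /r -scaleN1r addrC expand_linear scaleN1r addrC.
  rewrite [X in _ - X](_ : _ = expand t x) ?subrr//.
  by apply: eq_big_seq => u ut; rewrite expand_sym tt.
have nr : `|r| != 0 by rewrite normr_eq0.
pose u' := `|r|^-1 *: r.
have Eu' : expand t u' = 0.
  by rewrite /u' -[_ *: r]addr0 expand_linear Er scaler0 add0r expand0.
have u'1 : inner u' u' = 1 :> R.
  by rewrite /u' innerZl innerZr inner_sqr; field.
exists (u' :: t).
have Eold y : expand t y = y -> expand (u' :: t) y = y.
  move=> Ey; rewrite /expand big_cons -/(expand t y) -{1}Ey.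
  by rewrite expand_sym Eu' inner0r scale0r add0r.
split=> y; rewrite inE => /orP[/eqP ->|yt]; last 1 first.
- by apply: Eold; exact: ts.
- by rewrite /expand big_cons -/(expand t u') Eu' u'1 scale1r addr0.
- by apply: Eold; exact: tt.
rewrite /expand big_cons -/(expand t x).
have -> : inner x u' = `|r| :> R.
  have -> : inner x u' = inner r u' + inner (expand t x) u' :> R.
    by rewrite -innerDl subrK.
  by rewrite expand_sym Eu' inner0r addr0 innerZr inner_sqr; field.
by rewrite /u' scalerA divff// scale1r subrK.
Qed.

Lemma finite_dim_expand : finite_dim H -> exists t, forall x, expand t x = x.
Proof.
move=> [n [e eT]]; have [t [_ et]] := gram_schmidt [seq e i | i <- enum 'I_n].
exists t => x.
have : lspan (range e) x by rewrite eT.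
move=> [m [c [v [ev ->]]]].
elim/big_rec : _ => [|i y _ Ey]; first exact: expand0.
rewrite expand_linear Ey et//.
by have [j _ <-] := ev i; apply/mapP; exists j => //; rewrite mem_enum.
Qed.

(** A bounded set lies in the image of a compact box of coordinates under the
    continuous map that rebuilds a vector from its coordinates. *)
Lemma bounded_closed_compact_expand t (S : set H) (M : R) :
  (forall x, expand t x = x) -> closed S -> (forall x, S x -> `|x| <= M) ->
  compact S.
Proof.
move=> tE cS SM.
pose n := size t; pose phi (v : 'rV[R]_n) : H := \sum_(i < n) v ord0 i *: t`_i.
have cphi : continuous phi.
  move=> v; apply: (@cvg_big _ _ +%R 0 predT add_continuous _ (nbhs v) _
    (fun i (w : 'rV[R]_n) => w ord0 i *: t`_i)) => i _.
  by apply: cvgZr_tmp; exact: coord_continuous.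
pose B (i : 'I_n) : set R := `[- (M * `|t`_i|), M * `|t`_i|]%classic.
have cB : compact [set v : 'rV[R]_n | forall i, B i (v ord0 i)].
  by apply: rV_compact => i; exact: segment_compact.
apply: subclosed_compact cS (continuous_compact _ cB) _.
  by apply: continuous_subspaceT; exact: cphi.
move=> x Sx; exists (\row_i inner x t`_i) => [i|].
  rewrite mxE /B/= in_itv/= -ler_norml.
  by apply: le_trans (norm_cauchy_schwarz _ _) _; rewrite ler_wpM2r// SM.
rewrite -[RHS]tE /phi /expand (big_nth 0) big_mkord.
by apply: eq_bigr => i _; rewrite mxE.
Qed.

End finite_dimension.

Lemma expand_snd (R : realType) (X K : hilbertType R) (t : seq (hprod X K)) k :
  expand [seq u.2 | u <- t] k = (expand t (0, k)).2.
Proof.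
rewrite /expand big_map; elim: t => [|u t IH]; first by rewrite !big_nil.
by rewrite !big_cons IH hprod_innerE/= inner0l add0r.
Qed.

Section compactness.
Context (R : realType) (H : hilbertType R).

Lemma compact_pos_min (S : set H) (u : H -> R) : compact S -> continuous u ->
  (forall x, S x -> 0 < u x) -> exists2 d : R, 0 < d & forall x, S x -> d <= u x.
Proof.
move=> cS cu upos; have [->|/set0P S0] := eqVneq S set0; first by exists 1.
have [c cS' cmin] := compact_EVT_min S0 cS (continuous_subspaceT cu).
exists (u c); first by apply: upos; move: cS'; rewrite inE.
by move=> x Sx; apply: cmin; rewrite inE.
Qed.

End compactness.

(** * Hahn-Banach theorem in finite dimension *)

Section sublinear_minorants.
Context (R : realType) (H : hilbertType R).
Implicit Types (q : H -> R) (S : H -> set R).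

Definition sublinear q := (forall x y, q (x + y) <= q x + q y) /\
  (forall (a : R) x, 0 < a -> q (a *: x) = a * q x).

Lemma sublinear0 q : sublinear q -> q 0 = 0.
Proof. by move=> [_ h]; have := h 2 0 ltac:(by []); rewrite scaler0; lra. Qed.

Lemma sublinear_sum q (I : Type) (s : seq I) (F : I -> H) : sublinear q ->
  q (\sum_(i <- s) F i) <= \sum_(i <- s) q (F i).
Proof.
move=> sq; elim: s => [|i s IH]; first by rewrite !big_nil sublinear0.
by rewrite !big_cons; apply: le_trans (sq.1 _ _) _; rewrite lerD2l.
Qed.

(** Adding an element of S x to one of S (- x) gives an upper bound of an element
    of S 0, which is nonnegative: so S x is bounded below. *)
Lemma inf_sublinear S :
  (forall x, S x !=set0) ->
  (forall x y r r', S x r -> S y r' ->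
     exists2 r'', S (x + y) r'' & r'' <= r + r') ->
  (forall (a : R) x r, 0 < a -> S x r -> S (a *: x) (a * r)) ->
  (forall r, S 0 r -> 0 <= r) ->
  sublinear (fun x => inf (S x)) /\ forall x r, S x r -> inf (S x) <= r.
Proof.
move=> S0 SD SZ Spos.
have Slb x : has_lbound (S x).
  have [r0 Sr0] := S0 (- x); exists (- r0) => r Sr.
  have [r''] := SD _ _ _ _ Sr Sr0; rewrite subrr => /Spos h1 h2; lra.
have Sle x r : S x r -> inf (S x) <= r by move=> Sr; apply: ge_inf.
split=> //; split=> [x y|a x a0].
  rewrite -lerBlDr; apply: lb_le_inf => // r Sr.
  rewrite lerBlDl -lerBlDr; apply: lb_le_inf => // r' Sr'.
  have [r'' Sr'' le] := SD _ _ _ _ Sr Sr'; rewrite lerBlDl.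
  exact: le_trans (Sle _ _ Sr'') le.
have half (b : R) y : 0 < b -> inf (S (b *: y)) <= b * inf (S y).
  move=> b0; rewrite -ler_pdivrMl//; apply: lb_le_inf => // r Sr.
  by rewrite ler_pdivrMl//; apply/Sle/SZ.
apply/eqP; rewrite eq_le half//= -ler_pdivlMl//.
have := half a^-1 (a *: x); rewrite scalerA mulVf ?gt_eqF// scale1r invr_gt0.
exact.
Qed.

(** Take x |-> inf_(s >= 0) q (x + s u) - s q u. The value s = 0 shows that it is
    below q, and s = 1 that it is at most - q u at - u. The last inequality says
    that q' is linear on the line spanned by u, a property that every smaller
    sublinear function keeps. *)
Lemma sublinear_linearize q (u : H) : sublinear q ->
  exists q', [/\ sublinear q', forall x, q' x <= q x & q' u + q' (- u) <= 0].
Proof.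
move=> sq; have [qD qZ] := sq.
have qZ0 (s : R) x : 0 <= s -> q (s *: x) = s * q x.
  rewrite le_eqVlt => /orP[/eqP <-|]; last exact: qZ.
  by rewrite scale0r mul0r sublinear0.
pose S x := [set r | exists2 s : R, 0 <= s & r = q (x + s *: u) - s * q u].
have [||||sS leS] := @inf_sublinear S.
- by move=> x; exists (q (x + 0 *: u) - 0 * q u); exists 0.
- move=> x y r r' [s s0 ->] [s' s'0 ->].
  exists (q (x + y + (s + s') *: u) - (s + s') * q u).
    by exists (s + s') => //; rewrite addr_ge0.
  by have := qD (x + s *: u) (y + s' *: u); rewrite addrACA -scalerDl; lra.
- move=> a x r a0 [s s0 ->]; exists (a * s); first by rewrite mulr_ge0// ltW.
  by rewrite -scalerA -scalerDr qZ//; ring.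
- by move=> r [s s0 ->]; rewrite add0r qZ0// subrr.
exists (fun x => inf (S x)); split => // [x|].
  by apply: leS; exists 0 => //; rewrite scale0r addr0 mul0r subr0.
have h1 : inf (S u) <= q u.
  by apply: leS; exists 0 => //; rewrite scale0r addr0 mul0r subr0.
have h2 : inf (S (- u)) <= - q u.
  by apply: leS; exists 1 => //; rewrite scale1r addNr sublinear0// mul1r sub0r.
lra.
Qed.

Lemma sublinear_linearize_seq q (t : seq H) : sublinear q ->
  exists q', [/\ sublinear q', forall x, q' x <= q x &
    forall u, u \in t -> q' u + q' (- u) <= 0].
Proof.
elim: t q => [|u t IH] q sq; first by exists q.
have [q1 [s1 le1 u1]] := sublinear_linearize u sq.
have [q2 [s2 le2 u2]] := IH _ s1; exists q2; split=> // [x|v].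
  exact: le_trans (le2 _) (le1 _).
rewrite inE => /orP[/eqP ->|/u2//].
exact: le_trans (lerD (le2 _) (le2 _)) u1.
Qed.

(** Hahn-Banach: linearizing q along each vector of a spanning family leaves a
    linear function below q. *)
Lemma sublinear_minorant q (t : seq H) : (forall x, expand t x = x) ->
  sublinear q -> exists nu, forall x, inner nu x <= q x.
Proof.
move=> tE sq; have [q' [sq' leq' ut]] := sublinear_linearize_seq t sq.
have q'Z u (c : R) : u \in t -> q' (c *: u) = c * q' u.
  move=> /ut u0.
  have q'N : q' (- u) = - q' u.
    by have := sq'.1 u (- u); rewrite subrr sublinear0//; lra.
  have [c0|c0|<-] := ltgtP 0 c; first exact: sq'.2.
    rewrite -[c]opprK scaleNr -scalerN sq'.2 ?oppr_gt0// q'N; ring.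
  by rewrite scale0r mul0r sublinear0.
exists (\sum_(u <- t) q' u *: u) => x; apply: le_trans (leq' x).
have h : q' (- x) <= - inner (\sum_(u <- t) q' u *: u) x.
  rewrite -[in leLHS](tE x) /expand -sumrN inner_suml.
  apply: le_trans (sublinear_sum _ _ sq') _; rewrite -sumrN !big_seq.
  apply: ler_sum => u ut'; rewrite -scaleNr q'Z// innerZl (innerC u).
  by rewrite mulNr mulrC.
by have := sq'.1 x (- x); rewrite subrr sublinear0//; lra.
Qed.

End sublinear_minorants.

(** * Lagrange multipliers and fixed points *)

Section linear_span.
Context (R : realType) (H : hilbertType R).

Lemma subspace_lspan (S : set H) : subspace (lspan S).
Proof.
split=> [|a x y [n [c [v [Sv ->]]]] [m [d [w [Sw ->]]]]].
  by exists 0%N, (fun=> 0), (fun=> 0); split=> [[]//|]; rewrite big_ord0.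
exists (n + m)%N.
exists (fun i : 'I_(n + m)%N =>
  match fintype.split i with inl j => a * c j | inr j => d j end).
exists (fun i : 'I_(n + m)%N =>
  match fintype.split i with inl j => v j | inr j => w j end).
split=> [i|]; first by case: fintype.split.
rewrite big_split_ord/= scaler_sumr; congr (_ + _); apply: eq_bigr => i _.
  by rewrite -[lshift m i]/(unsplit (inl i)) unsplitK scalerA.
by rewrite -[rshift n i]/(unsplit (inr i)) unsplitK.
Qed.

Lemma cone_lspan (S : set H) : cone S `<=` lspan S.
Proof.
move=> x [l [s [l0 Ss ->]]]; exists 1%N, (fun=> l), (fun=> s).
by split=> //; rewrite big_ord1.
Qed.

End linear_span.

Section lagrange_multipliers.
Context (R : realType) (X K : hilbertType R) (A : {linear X -> K}).
Context (f : X -> \bar R) (g : K -> \bar R).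
Hypotheses (bA : bounded_operator A) (gf : gamma0 f) (gg : gamma0 g).
Notation Sp := (argmin setT (fun x => (f x + g (A x))%E)).
Notation C := [set y - A x | y in edom g & x in edom f].

Lemma argmin_edom x : C 0 -> Sp x -> edom f x /\ edom g (A x).
Proof.
move=> [y0 gy0 [x0 fx0 /eqP]]; rewrite subr_eq0 => /eqP yE [_ /(_ x0 I)].
have [fN _ _ _] := gf; have [gN _ _ _] := gg.
rewrite yE in gy0; rewrite (gamma0_fin gf fx0) (gamma0_fin gg gy0) /edom/=.
case: (f x) (fN x) => [a||]// _; case: (g (A x)) (gN (A x)) => [b||]// _ _.
by rewrite !ltry.
Qed.

(** The multiplier is a linear function below the directional derivative at 0 of
    the value function u |-> inf_x f x + g (A x + u) - min. The qualification
    condition says that every direction of the closed span V of its domain is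
    feasible, so this derivative is finite on V; ignoring the displacements
    orthogonal to V makes it finite everywhere. *)
Lemma lagrange_multiplier (t : seq K) (xb : X) : (forall k, expand t k = k) ->
  sri C 0 -> Sp xb ->
  exists nu, subgrad g (A xb) nu /\ subgrad f xb (- adjoint A nu).
Proof.
move=> tE [C0 coneC] Spx; have [fxb gxb] := argmin_edom C0 Spx.
have [_ xbmin] := Spx.
have C0E : [set y - 0 | y in C] = C.
  apply/seteqP; split => [u [y Cy]|u Cu]; first by rewrite subr0 => <-.
  by exists u; rewrite ?subr0.
rewrite {}C0E in coneC; set V := lspan C.
have VE : V = cone C.
  apply/seteqP; split; last exact: cone_lspan.
  by rewrite coneC; exact: subset_closure.
have cV : closed V by rewrite VE coneC; exact: closed_closure.
have CV u : C u -> V u by rewrite VE => Cu; exists 1, u; rewrite scale1r.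
pose F x := fine (f x); pose G y := fine (g y).
have convdom (H : hilbertType R) (h : H -> \bar R) (s s' : R) u v :
    gamma0 h -> 0 < s -> 0 < s' -> edom h u -> edom h v ->
    exists w, [/\ edom h w, (s + s') *: w = s *: u + s' *: v
      & (s + s') * fine (h w) <= s * fine (h u) + s' * fine (h v)].
  move=> gh s0 s'0 hu hv; have [_ _ _ ch] := gh.
  have ss0 : 0 < s + s' by rewrite addr_gt0.
  pose tau := s / (s + s').
  have tau01 : 0 <= tau <= 1.
    rewrite /tau divr_ge0 ?(ltW s0) ?(ltW ss0)//=.
    by rewrite ler_pdivrMr// mul1r lerDl ltW.
  have tau1 : (s + s') * tau = s by rewrite mulrC divfK ?gt_eqF.
  have tau2 : (s + s') * (1 - tau) = s' by rewrite mulrBr tau1 mulr1 addrC addKr.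
  exists (tau *: u + (1 - tau) *: v).
  have h1 := econvex_fin ch tau01 (gamma0_fin gh hu) (gamma0_fin gh hv).
  have hw : edom h (tau *: u + (1 - tau) *: v) by exact: le_lt_trans h1 (ltry _).
  split=> //; first by rewrite scalerDr !scalerA tau1 tau2.
  move: h1; rewrite (gamma0_fin gh hw) lee_fin -(ler_pM2l ss0).
  move=> /le_trans; apply.
  rewrite mulrDr (mulrA _ tau) (mulrA _ (1 - tau)) tau1 tau2; exact: lexx.
pose m := F xb + G (A xb).
(* S h: the difference quotients of the value function in the direction h, up to
   a displacement w orthogonal to V *)
pose S h := [set r | exists (s : R) x y w, [/\ 0 < s, edom f x, edom g y,
  forall v, V v -> inner w v = 0 :> R &
  h = s *: (y - A x) + w /\ r = s * (F x + G y - m)]].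
have [||||sS leS] := @inf_sublinear _ _ S.
- move=> h; have [p [Vp hp]] := orthogonal_projection h cV (subspace_lspan C).
  move: (Vp); rewrite VE => -[s [_ [s0 [y gy [x fx <-]] pE]]].
  exists (s * (F x + G y - m)), s, x, y, (h - p); split => //.
  by rewrite -pE subrKC.
- move=> h k r r' [s [x [y [w [s0 fx gy wV [-> ->]]]]]].
  move=> [s' [x' [y' [w' [s'0 fx' gy' wV' [-> ->]]]]]].
  have [x2 [fx2 x2E lex2]] := convdom _ _ _ _ _ _ gf s0 s'0 fx fx'.
  have [y2 [gy2 y2E ley2]] := convdom _ _ _ _ _ _ gg s0 s'0 gy gy'.
  exists ((s + s') * (F x2 + G y2 - m)); last by rewrite /F /G; lra.
  exists (s + s'), x2, y2, (w + w'); split => //; first exact: addr_gt0.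
    by move=> v Vv; rewrite innerDl wV// wV'// addr0.
  split => //; have -> : (s + s') *: (y2 - A x2) =
      s *: y + s' *: y' - (s *: A x + s' *: A x').
    by rewrite scalerBr y2E -!linearZ -linearD -x2E linearZ.
  by apply: inner_inj => u; rewrite !innerE; ring.
- move=> a h r a0 [s [x [y [w [s0 fx gy wV [-> ->]]]]]].
  exists (a * s), x, y, (a *: w); split => //; first exact: mulr_gt0.
    by move=> v Vv; rewrite innerZl wV// mulr0.
  by rewrite scalerDr scalerA mulrA.
- move=> _ [s [x [y [w [s0 fx gy wV [E ->]]]]]].
  have Cyx : C (y - A x) by exists y => //; exists x.
  have : inner (s *: (y - A x) + w) (y - A x) = 0 :> R by rewrite -E inner0l.
  rewrite innerDl wV ?addr0; last exact: CV.
  rewrite innerZl => /eqP; rewrite mulf_eq0 gt_eqF//= => /eqP/inner_eq0/eqP.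
  rewrite subr_eq0 => /eqP yE; rewrite mulr_ge0 ?(ltW s0)//.
  have := xbmin x I; rewrite yE in gy *.
  rewrite (gamma0_fin gf fx) (gamma0_fin gg gy).
  rewrite (gamma0_fin gf fxb) (gamma0_fin gg gxb).
  by rewrite -!EFinD lee_fin /m /F /G; lra.
have [nu hnu] := sublinear_minorant tE sS.
have key x y : edom f x -> edom g y -> inner nu (y - A x) <= F x + G y - m.
  move=> fx gy; apply: le_trans (hnu _) (leS _ _ _).
  exists 1, x, y, 0; split=> // [v _|]; first by rewrite inner0l.
  by rewrite scale1r addr0 mul1r.
exists nu; split; split => // z.
- apply: le_on_edom => gz.
  rewrite (gamma0_fin gg gxb) (gamma0_fin gg gz) lee_fin.
  by have := key _ _ fxb gz; rewrite /m /F /G; lra.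
- apply: le_on_edom => fz.
  rewrite (gamma0_fin gf fxb) (gamma0_fin gf fz) lee_fin.
  rewrite innerNl innerC -(adjointP bA) linearB/=.
  by have := key _ _ fz gxb; rewrite /m /F /G innerC !innerE; lra.
Qed.

(** Write z = (p + A^* nu, A p - nu). The reflection through the graph of A
    changes the sign of nu, so the proximity steps fix z exactly when
    - A^* nu and nu are subgradients of f at p and of g at A p. The sum of the two
    subgradient inequalities, in which nu cancels, is the optimality of p. *)
Lemma Fix_DRS1_argmin z : Fix (DRS1 f g A) z -> Sp (Xi A z).
Proof.
move=> zT.
have [e1 e2] : 2 *: prox f (2 *: Xi A z - z.1) - (2 *: Xi A z - z.1) = z.1 /\
    2 *: prox g (2 *: A (Xi A z) - z.2) - (2 *: A (Xi A z) - z.2) = z.2.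
  by have := congr1 fst zT; have := congr1 snd zT.
have half (H : hilbertType R) (u p w : H) : 2 *: u - (2 *: p - w) = w -> u = p.
  move=> E; apply: inner_inj => h; have := congr1 (fun v => inner v h : R) E.
  by rewrite !innerE; lra.
have hf := prox_subgrad (2 *: Xi A z - z.1) gf.
rewrite (half _ _ _ _ e1) in hf.
have hg := prox_subgrad (2 *: A (Xi A z) - z.2) gg.
rewrite (half _ _ _ _ e2) in hg.
have uf : 2 *: Xi A z - z.1 - Xi A z = - adjoint A (multiplier A z).
  by rewrite [z.1](Xi_dec1 A); apply: inner_inj => h; rewrite !innerE; ring.
have ug : 2 *: A (Xi A z) - z.2 - A (Xi A z) = multiplier A z.
  by rewrite [z.2](Xi_dec2 bA); apply: inner_inj => h; rewrite !innerE; ring.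
move: hf hg; rewrite uf ug.
move: (Xi A z) (multiplier A z) => p nu [fp hf] [gp hg].
split=> // x _.
apply: le_trans (leeD (hf x) (hg (A x))).
rewrite (gamma0_fin gf fp) (gamma0_fin gg gp) -!EFinD lee_fin.
have : inner (- adjoint A nu) (x - p) = - inner nu (A x - A p) :> R.
  by rewrite -linearB innerNl innerC -(adjointP bA) innerC.
by lra.
Qed.

Lemma Fix_DRS1_multiplier p nu :
  subgrad g (A p) nu -> subgrad f p (- adjoint A nu) ->
  exists z, Fix (DRS1 f g A) z /\ Xi A z = p.
Proof.
move=> hg hf; pose z : hprod X K := (p + adjoint A nu, A p - nu).
have nuE : resAA A (A z.1 - z.2) = nu.
  apply: (resAA_uniq bA) => /=; rewrite linearD.
  by apply: inner_inj => h; rewrite !innerE; ring.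
have zp : Xi A z = p by rewrite /Xi nuE /= addrK.
exists z; split => //; rewrite /Fix/= /DRS1 -!/(Xi A z) zp /=.
have -> : 2 *: p - (p + adjoint A nu) = p + - adjoint A nu.
  by apply: inner_inj => h; rewrite !innerE; ring.
have -> : 2 *: A p - (A p - nu) = A p + nu.
  by apply: inner_inj => h; rewrite !innerE; ring.
rewrite (subgrad_prox gf hf) (subgrad_prox gg hg).
by congr pair; apply: inner_inj => h; rewrite !innerE; ring.
Qed.

End lagrange_multipliers.

(** * Real sequences and distances to sets *)

Section real_sequences.
Context (R : realType).
Implicit Types (u lam D : R^nat).

Lemma series_square_cvg0 lam : (forall n, 0 <= lam n) ->
  cvgn (series (fun n => lam n ^+ 2)) -> lam @ \oo --> 0.
Proof.
move=> lam0 /cvg_series_cvg_0 h.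
have -> : lam = (fun n => Num.sqrt (lam n ^+ 2)).
  by apply/funext => n; rewrite sqrtr_sqr ger0_norm.
rewrite -sqrtr0; apply: (@cvg_comp _ _ _ (fun n => lam n ^+ 2) Num.sqrt _ _ _ h).
exact: sqrt_continuous.
Qed.

Lemma vanishing_le u (e : R) : u @ \oo --> 0 -> 0 < e ->
  exists N : nat, forall n, (N <= n)%N -> u n <= e.
Proof.
move=> /cvgrPdist_le h e0; have [N _ hN] := h e e0; exists N => n /hN.
by rewrite sub0r normrN; apply: le_trans; exact: ler_norm.
Qed.

(** The divergence of the series brings D below eps / 2 at some late index. From
    there on D stays below eps: it decreases when it is above eps / 2, and
    otherwise grows by at most C lam_n, which is eventually below eps / 2. *)
Lemma cvg0_of_decrease lam D (C : R) (N0 : nat) :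
  (forall n, 0 <= lam n) -> (forall n, 0 <= D n) ->
  lam @ \oo --> 0 -> ~ cvgn (series lam) ->
  0 <= C ->
  (forall n, (N0 <= n)%N -> D n.+1 <= D n + C * lam n) ->
  (forall eps : R, 0 < eps -> exists (delta : R) (N : nat), 0 < delta /\
     forall n, (N <= n)%N -> eps <= D n -> D n.+1 <= D n - delta * lam n) ->
  forall eps : R, 0 < eps -> exists N : nat, forall n, (N <= n)%N -> D n <= eps.
Proof.
move=> lam0 D0 lamcvg lamdiv C0 hup hdown eps eps0.
have e20 : 0 < eps / 2 by rewrite divr_gt0.
have [delta [N1 [delta0 hN1]]] := hdown _ e20.
have C10 : 0 < C + 1 by rewrite ltr_wpDl.
have [N2 hN2] := vanishing_le lamcvg (divr_gt0 e20 C10).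
pose N := maxn N0 (maxn N1 N2).
have NE n : (N <= n)%N -> [/\ (N0 <= n)%N, (N1 <= n)%N & (N2 <= n)%N].
  by rewrite /N !geq_max => /andP[-> /andP[-> ->]].
have [m Nm Dm] : exists2 m, (N <= m)%N & D m < eps / 2.
  apply: contrapT => nex.
  have big n : (N <= n)%N -> eps / 2 <= D n.
    by move=> Nn; rewrite leNgt; apply/negP => Dn; apply: nex; exists n.
  have sumle k : delta * series lam (N + k)%N <=
      delta * series lam N + D N - D (N + k)%N.
    elim: k => [|k IH]; first by rewrite addn0; lra.
    rewrite addnS seriesEnat/= big_nat_recr//= -/(series lam _).
    have Nk : (N <= N + k)%N by exact: leq_addr.
    have [_ h1 _] := NE _ Nk; have := hN1 _ h1 (big _ Nk).
    by move: IH; rewrite seriesEnat/=; lra.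
  have ndl : nondecreasing_seq (series lam).
    by apply: nondecreasing_series => n _ _; exact: lam0.
  apply: lamdiv; apply: nondecreasing_is_cvgn => //.
  exists (delta^-1 * (delta * series lam N + D N)) => _ [n _ <-].
  apply: le_trans (ndl _ _ (leq_addl N n)) _.
  rewrite -ler_pdivrMl ?invr_gt0// invrK; apply: le_trans (sumle n) _.
  by rewrite gerBl D0.
exists m => n mn; rewrite -(subnKC mn); elim: (n - m)%N => [|k IH].
  by rewrite addn0; lra.
rewrite addnS; have [h0 h1 h2] := NE _ (leq_trans Nm (leq_addr k m)).
have [Dk|Dk] := leP (eps / 2) (D (m + k)%N).
  apply: le_trans (hN1 _ h1 Dk) _.
  by have := mulr_ge0 (ltW delta0) (lam0 (m + k)%N); lra.
apply: le_trans (hup _ h0) _.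
have : C * lam (m + k)%N <= eps / 2.
  apply: le_trans (_ : (C + 1) * lam (m + k)%N <= _).
    by rewrite ler_wpM2r// lerDl.
  by rewrite -ler_pdivlMl// mulrC hN2.
lra.
Qed.

(** Since 1 + x <= exp x, the product of the factors 1 + a lam_n^2 is at most the
    exponential of a convergent series. *)
Lemma bounded_of_growth lam m (a : R) (N : nat) : 0 <= a ->
  cvgn (series (fun n => lam n ^+ 2)) -> (forall n, 0 <= m n) ->
  (forall n, (N <= n)%N -> m n.+1 <= (1 + a * lam n ^+ 2) * m n) ->
  exists B : R, forall n, (N <= n)%N -> m n <= B.
Proof.
move=> a0 cQ m0 hm; pose Q := series (fun n => lam n ^+ 2).
have ndQ : nondecreasing_seq Q.
  by apply: nondecreasing_series => n _ _; exact: sqr_ge0.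
have key k : m (N + k)%N <= m N * expR (a * (Q (N + k)%N - Q N)).
  elim: k => [|k IH]; first by rewrite addn0 subrr mulr0 expR0 mulr1.
  rewrite addnS; apply: le_trans (hm _ (leq_addr _ _)) _.
  have -> : a * (Q (N + k).+1 - Q N) =
      a * lam (N + k)%N ^+ 2 + a * (Q (N + k)%N - Q N).
    by rewrite /Q !seriesEnat/= big_nat_recr//=; ring.
  rewrite expRD [leRHS]mulrCA; apply: ler_pM => //.
    by apply: addr_ge0 => //; apply: mulr_ge0 => //; exact: sqr_ge0.
  exact: expR_ge1Dx.
exists (m N * expR (a * (limn Q - Q N))) => n Nn.
rewrite -(subnKC Nn); apply: le_trans (key _) _.
rewrite ler_wpM2l// ler_expR ler_wpM2l// lerD2r.
exact: nondecreasing_cvgn_le.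
Qed.

End real_sequences.

Section distance.
Context (R : realType).
Implicit Types (H : hilbertType R).

Lemma dist_le H (O : set H) x y : O y -> dist O x <= `|x - y|.
Proof.
move=> Oy; apply: ge_inf; last by exists y.
by exists 0 => _ [w _ <-].
Qed.

Lemma dist_ge0 H (O : set H) x : 0 <= dist O x.
Proof.
have [->|/set0P[y Oy]] := eqVneq O set0; first by rewrite /dist image_set0 inf0.
by apply: lb_le_inf => [|_ [w _ <-]//]; exists `|x - y|, y.
Qed.

Lemma le_dist H (O : set H) x (r : R) : O !=set0 ->
  (forall y, O y -> r <= `|x - y|) -> r <= dist O x.
Proof.
move=> [y Oy] h; apply: lb_le_inf => [|_ [w Ow <-]]; last exact: h.
by exists `|x - y|, y.
Qed.

Lemma dist_lipschitz H (O : set H) x x' : O !=set0 ->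
  `|dist O x - dist O x'| <= 1 * `|x - x'|.
Proof.
move=> O0; have half u v : dist O u - dist O v <= `|u - v|.
  rewrite lerBlDr -lerBlDl; apply: le_dist => // y Oy.
  rewrite lerBlDl; apply: le_trans (dist_le u Oy) _.
  by rewrite -(subrKA v u) ler_normD.
by rewrite mul1r ler_norml half andbT lerNl opprB distrC half.
Qed.

Lemma dist_sqr_le H (O : set H) x x' (s : R) : O !=set0 ->
  (forall y, O y -> `|x' - y| ^+ 2 <= `|x - y| ^+ 2 + s) ->
  dist O x' ^+ 2 <= dist O x ^+ 2 + s.
Proof.
move=> O0 h; rewrite leNgt; apply/negP => lt.
have dd : dist O x ^+ 2 < dist O x' ^+ 2 - s by lra.
have sq : dist O x < Num.sqrt (dist O x' ^+ 2 - s).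
  rewrite -[ltLHS]ger0_norm ?dist_ge0// -sqrtr_sqr ltr_sqrt//.
  by rewrite (le_lt_trans _ dd)// sqr_ge0.
suff : Num.sqrt (dist O x' ^+ 2 - s) <= dist O x by rewrite leNgt sq.
apply: le_dist => // y Oy; rewrite -[leRHS]ger0_norm// -sqrtr_sqr ler_wsqrtr//.
rewrite lerBlDr; apply: le_trans (h _ Oy).
by rewrite ler_sqr ?nnegrE ?dist_ge0// dist_le.
Qed.

Lemma dist_mono (H H' : hilbertType R) (O : set H) (O' : set H') x x' :
  O !=set0 -> (forall y, O y -> exists2 y', O' y' & `|x' - y'| <= `|x - y|) ->
  dist O' x' <= dist O x.
Proof.
move=> O0 h; apply: le_dist => // y Oy; have [y' O'y' le] := h y Oy.
exact: le_trans (dist_le _ O'y') le.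
Qed.

End distance.

(** * Convergence of the hybrid steepest descent method *)

Section nonexpansive_maps.
Context (R : realType) (H : hilbertType R) (T : H -> H).
Hypothesis Tne : forall x y, `|T x - T y| <= `|x - y|.
Implicit Types (x y z p : H).

Lemma residual_monotone x y : 0 <= inner (x - T x - (y - T y)) (x - y) :> R.
Proof.
have -> : inner (x - T x - (y - T y)) (x - y) =
    `|x - y| ^+ 2 - inner (T x - T y) (x - y).
  by rewrite -inner_sqr -innerNl -innerDl; congr (inner _ _);
    apply: inner_inj => h; rewrite !innerE; ring.
rewrite subr_ge0; apply: le_trans (cauchy_schwarz _ _) _.
by rewrite expr2 ler_wpM2r.
Qed.

Lemma residual_ge z p : Fix T p -> `|z - T z| ^+ 2 <= 2 * inner (z - T z) (z - p).
Proof.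
move=> pT; have : `|T z - p| ^+ 2 <= `|z - p| ^+ 2.
  by rewrite ler_sqr ?nnegrE// -{1}pT Tne.
have -> : T z - p = (z - p) - (z - T z).
  by apply: inner_inj => h; rewrite !innerE; ring.
by rewrite sqr_normB (innerC (z - p)); lra.
Qed.

Lemma relax_sqr (a : R) z p :
  `|relax a T z - p| ^+ 2 =
  `|z - p| ^+ 2 - 2 * a * inner (z - T z) (z - p) + a ^+ 2 * `|z - T z| ^+ 2.
Proof.
have -> : relax a T z - p = (z - p) - a *: (z - T z).
  by rewrite /relax; apply: inner_inj => h; rewrite !innerE; ring.
rewrite sqr_normB innerZr normrZ exprMn real_normK ?num_real//.
by rewrite (innerC (z - p)); ring.
Qed.

Lemma relax_nonexpansive (a : R) x y : 0 < a < 1 ->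
  `|relax a T x - relax a T y| <= `|x - y|.
Proof.
move=> /andP[a0 a1].
have -> : relax a T x - relax a T y = (1 - a) *: (x - y) + a *: (T x - T y).
  by rewrite /relax; apply: inner_inj => h; rewrite !innerE; ring.
apply: le_trans (ler_normD _ _) _; rewrite !normrZ !gtr0_norm ?subr_gt0//.
have : a * `|T x - T y| <= a * `|x - y| by rewrite ler_wpM2l// ltW.
by lra.
Qed.

Lemma relax_Fix (a : R) p : Fix T p -> relax a T p = p.
Proof. by move=> pT; rewrite /relax pT -scalerDl subrK scale1r. Qed.

End nonexpansive_maps.

Section hybrid_steepest_descent.
Context (R : realType) (H : hilbertType R) (t : seq H).
Hypothesis tE : forall x, expand t x = x.
Context (T : H -> H) (Theta : H -> R) (G : H -> H) (L a : R) (lam : R^nat).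
Hypothesis Tne : forall x y, `|T x - T y| <= `|x - y|.
Hypothesis hG : forall x y, Theta x + inner (G x) (y - x) <= Theta y.
Hypothesis LG : forall x y, `|G x - G y| <= L * `|x - y|.
Hypothesis a01 : 0 < a < 1.
Hypothesis hlam : l2_not_l1 lam.
Context (z : nat -> H).
Notation w n := (relax a T (z n)).
Hypothesis zE : forall n, z n.+1 = w n - lam n *: G (w n).
Notation Gamma := (argmin (Fix T) (fun v => (Theta v)%:E)).

Let residual_continuous : continuous (fun v => `|v - T v|).
Proof.
apply: (@lipschitz_continuous _ _ R^o 2) => u v.
apply: le_trans (ler_dist_dist _ _) _.
have -> : u - T u - (v - T v) = (u - v) - (T u - T v).
  by apply: inner_inj => h; rewrite !innerE; ring.
by apply: le_trans (ler_normB _ _) _; have := Tne u v; lra.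
Qed.

(** On a sphere surrounding the bounded set Fix T the residual x - T x is bounded
    away from 0, by compactness, and points outwards. Its monotonicity propagates
    this along the rays issued from p: <v - T v, v - p> is at least a multiple of
    |v - p|, so the relaxed step decreases |v - p|^2 by such a multiple. *)
Lemma relax_far_decrease p (M : R) :
  Fix T p -> (forall x, Fix T x -> `|x| <= M) ->
  exists rho c : R, [/\ 0 < rho, 0 < c & forall v, rho <= `|v - p| ->
    `|relax a T v - p| <= `|v - p| - c].
Proof.
move=> pT MT; have /andP[a0 a1] := a01.
pose rho := M + `|p| + 1.
have rho0 : 0 < rho.
  by rewrite /rho; have := MT _ pT; have := normr_ge0 p; lra.
pose S := [set s | `|s - p| = rho].
have cS : compact S.
  apply: (bounded_closed_compact_expand tE (M := rho + `|p|)) => [|s Ss].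
    have -> : S = (fun s => `|s - p|) @^-1` [set rho] by [].
    apply: closed_comp; last exact: closed_eq.
    move=> s _; apply: (@lipschitz_continuous _ _ R^o 1) => {}s s'.
    rewrite mul1r; apply: le_trans (ler_dist_dist _ _) _.
    by rewrite opprB addrA subrK.
  by rewrite -[in leLHS](subrK p s) -Ss ler_normD.
have [|d d0 dS] := compact_pos_min cS residual_continuous.
  move=> s Ss; rewrite normr_gt0 subr_eq0; apply/eqP => sT.
  have := MT s (esym sT); have := ler_normB s p; rewrite Ss /rho; lra.
pose c := 2 * a * (1 - a) * (d ^+ 2 / (2 * rho)).
have c0 : 0 < c.
  by rewrite /c !mulr_gt0 ?invr_gt0 ?subr_gt0 ?exprn_gt0 ?mulr_gt0.
exists rho, (c / 2); split; rewrite ?divr_gt0// => v vrho.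
set r := `|v - p|.
have r0 : 0 < r by exact: lt_le_trans vrho.
have inw : d ^+ 2 / (2 * rho) * r <= inner (v - T v) (v - p).
  (* s is the point of the sphere on the ray from p to v *)
  pose k := rho / r; pose s := p + k *: (v - p).
  have k1 : k <= 1 by rewrite ler_pdivrMr// mul1r.
  have sp : s - p = k *: (v - p) by rewrite /s addrC addKr.
  have Ss : S s.
    by rewrite /S/= sp normrZ ger0_norm ?divr_ge0 ?ltW// divfK// gt_eqF.
  have vs : v - s = (1 - k) *: (v - p).
    by rewrite /s; apply: inner_inj => h; rewrite !innerE; ring.
  have low : inner (s - T s) (v - p) <= inner (v - T v) (v - p).
    have := residual_monotone Tne v s; rewrite vs innerZr.
    rewrite innerDl innerNl => mon.
    have [k1'|k1'] := eqVneq k 1; last first.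
      have k1lt : 0 < 1 - k by rewrite subr_gt0 lt_neqAle k1'.
      by move: mon; rewrite pmulr_rge0// subr_ge0.
    have -> : s = v by rewrite /s k1' scale1r subrKC.
    exact: lexx.
  apply: le_trans low; have := residual_ge Tne s pT; rewrite sp innerZr.
  have : d ^+ 2 <= `|s - T s| ^+ 2.
    by rewrite ler_sqr ?nnegrE ?(ltW d0)//; exact: dS.
  move=> h1 h2; have {h1 h2} h : d ^+ 2 <= 2 * (k * inner (s - T s) (v - p)).
    exact: le_trans h1 h2.
  have -> : inner (s - T s) (v - p) =
    (2 * (k * inner (s - T s) (v - p))) / (2 * rho) * r.
    by rewrite /k; field; rewrite !gt_eqF.
  by rewrite ler_pM2r// ler_pM2r// invr_gt0 mulr_gt0.
have sq : `|relax a T v - p| ^+ 2 <= r ^+ 2 - c * r.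
  rewrite relax_sqr -/r.
  have := ler_wpM2l (sqr_ge0 a) (residual_ge Tne v pT).
  have aa : 0 <= 2 * a * (1 - a) by rewrite !mulr_ge0 ?subr_ge0 ?ltW.
  have := ler_wpM2l aa inw; rewrite mulrA -/c.
  by move: (inner _ _) => i; lra.
have rc : 0 <= r - c / 2.
  have : 0 <= r * (r - c) by apply: le_trans (sqr_ge0 _) (le_trans sq _); lra.
  by rewrite pmulr_rge0//; lra.
rewrite -ler_sqr ?nnegrE//; apply: le_trans sq _.
by have := sqr_ge0 c; lra.
Qed.

Let lam0 n : 0 <= lam n. Proof. by case: hlam. Qed.

Let lam_cvg0 : lam @ \oo --> 0.
Proof. by have [h0 h1 _] := hlam; exact: series_square_cvg0. Qed.

(** By monotonicity of G, the map v |-> v - l G v is Lipschitz with constant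
    sqrt (1 + L^2 l^2), which is at most 1 + L^2 l^2 / 2. *)
Lemma gradient_step_le v p (l : R) : 0 <= l ->
  `|v - l *: G v - p| <= (1 + L ^+ 2 / 2 * l ^+ 2) * `|v - p| + l * `|G p|.
Proof.
move=> l0; have -> : v - l *: G v - p = (v - p - l *: (G v - G p)) - l *: G p.
  by apply: inner_inj => h; rewrite !innerE; ring.
apply: le_trans (ler_normB _ _) _; rewrite normrZ (ger0_norm l0) lerD2r.
have q0 : 0 <= L ^+ 2 / 2 * l ^+ 2.
  by rewrite mulr_ge0 ?sqr_ge0// divr_ge0// sqr_ge0.
rewrite -ler_sqr ?nnegrE ?mulr_ge0 ?addr_ge0//.
rewrite sqr_normB innerZr normrZ (ger0_norm l0) !exprMn.
have mon : 0 <= inner (v - p) (G v - G p).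
  have := hG v p; have := hG p v; rewrite !innerE.
  by rewrite (innerC v) (innerC v) (innerC p) (innerC p); lra.
have lip : `|G v - G p| ^+ 2 <= L ^+ 2 * `|v - p| ^+ 2.
  by rewrite -exprMn ler_sqr ?nnegrE// (le_trans _ (LG v p)).
have := ler_wpM2l (sqr_ge0 l) lip; have := mulr_ge0 l0 mon.
have := mulr_ge0 (sqr_ge0 (L ^+ 2 / 2 * l ^+ 2)) (sqr_ge0 `|v - p|).
by move: (inner _ _) (`|G v - G p| ^+ 2) (`|v - p| ^+ 2) => i g u; lra.
Qed.

(** Far from p, the decrease c of the relaxed step absorbs the drift lam_n |G p|,
    and only the factors 1 + L^2 lam_n^2 / 2 remain, whose product converges. *)
Lemma iterates_bounded p (M : R) : Fix T p -> (forall x, Fix T x -> `|x| <= M) ->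
  exists (B : R) (N : nat), forall n, (N <= n)%N -> `|z n - p| <= B.
Proof.
move=> pT MT; have [rho [c [rho0 c0 far]]] := relax_far_decrease pT MT.
have g0 : 0 < `|G p| + 1 by rewrite ltr_wpDl.
have [N hN] := vanishing_le lam_cvg0 (divr_gt0 c0 g0).
(* truncating the distance from below makes the same recursion hold near p *)
pose m n := Num.max `|z n - p| (rho + c).
have [_ clam _] := hlam.
have b0 : 0 <= L ^+ 2 / 2 by rewrite divr_ge0// sqr_ge0.
have [||B hB] := bounded_of_growth (m := m) (N := N) b0 clam.
- by move=> n; rewrite le_max normr_ge0.
- move=> n Nn; set q := 1 + _.
  have q1 : 1 <= q by rewrite lerDl mulr_ge0// sqr_ge0.
  have lc : lam n * `|G p| <= c.
    have := hN n Nn; rewrite ler_pdivlMr//; have := lam0 n; lra.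
  have step := gradient_step_le (w n) p (lam0 n); rewrite -zE -/q in step.
  have mle : rho + c <= q * m n.
    apply: le_trans (_ : m n <= _); first by rewrite le_max lexx orbT.
    by rewrite ler_peMl// le_max normr_ge0.
  rewrite {1}/m ge_max mle andbT; apply: le_trans step _.
  have [zr|zr] := leP rho `|z n - p|.
    have h1 := far _ zr; have h2 : `|w n - p| + c <= m n.
      by apply: le_trans (_ : `|z n - p| <= _); [lra|rewrite le_max lexx].
    have h3 := ler_wpM2l (le_trans ler01 q1) h2.
    have := ler_wpM2r (ltW c0) q1; lra.
  have h1 : `|w n - p| <= `|z n - p|.
    by rewrite -{1}(relax_Fix a pT); exact: relax_nonexpansive.
  have h2 : `|w n - p| + c <= m n.
    by apply: le_trans (_ : rho + c <= _); [lra|rewrite le_max lexx orbT].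
  have h3 := ler_wpM2l (le_trans ler01 q1) h2.
  have := ler_wpM2r (ltW c0) q1; lra.
exists B, N => n /hB; apply: le_trans; rewrite /m le_max lexx; exact: isT.
Qed.

Lemma step_sqr_le n y : Fix T y ->
  `|z n.+1 - y| ^+ 2 <= `|z n - y| ^+ 2 - a * (1 - a) * `|z n - T (z n)| ^+ 2
    - 2 * lam n * (Theta (w n) - Theta y) + lam n ^+ 2 * `|G (w n)| ^+ 2.
Proof.
move=> yT; have /andP[a0 a1] := a01.
have -> : z n.+1 - y = (w n - y) - lam n *: G (w n).
  by rewrite zE; apply: inner_inj => h; rewrite !innerE; ring.
rewrite sqr_normB innerZr normrZ exprMn real_normK ?num_real// relax_sqr.
have h1 := ler_wpM2l (ltW a0) (residual_ge Tne (z n) yT).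
have h2 := ler_wpM2l (lam0 n) (hG (w n) y).
have -> : inner (w n - y) (G (w n)) = - inner (G (w n)) (y - w n) :> R.
  by rewrite innerC !innerE; ring.
move: h1 h2; move: (inner _ (z n - y)) (inner (G _) _) (`|G (w n)| ^+ 2) => i j k.
by move: (`|z n - T (z n)| ^+ 2) (`|z n - y| ^+ 2) => b d; lra.
Qed.

Lemma Theta_continuous : continuous Theta.
Proof. exact: continuous_of_gradient hG LG. Qed.

(** A point where both quantities are nonpositive is fixed by T, hence by the
    relaxation, and minimizes Theta over Fix T, so it is in Gamma. Away from Gamma
    the larger of the two is therefore positive, and compactness gives d. *)
Lemma progress_away_from_solutions p (B eps : R) : Gamma p -> 0 < eps ->
  exists2 d : R, 0 < d & forall v, `|v - p| <= B -> eps <= dist Gamma v ->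
    d <= Theta (relax a T v) - Theta p \/ d <= `|v - T v|.
Proof.
move=> Gp eps0; have [pT pmin] := Gp.
have G0 : Gamma !=set0 by exists p.
pose S := [set v | `|v - p| <= B] `&` [set v | eps <= dist Gamma v].
have cdist : continuous (dist Gamma).
  by apply: (@lipschitz_continuous _ _ R^o 1) => u v; exact: dist_lipschitz.
have cnorm : continuous (fun v : H => `|v - p|).
  apply: (@lipschitz_continuous _ _ R^o 1) => u v.
  rewrite mul1r; apply: le_trans (ler_dist_dist _ _) _.
  by rewrite opprB addrA subrK.
have crel : continuous (fun v => Theta (relax a T v) - Theta p).
  have cr : continuous (relax a T).
    apply: (@lipschitz_continuous _ _ _ 1) => u v.
    by rewrite mul1r; exact: relax_nonexpansive.
  move=> v; apply: cvgB; last exact: cvg_cst.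
  by apply: (cvg_comp _ _ (cr v)); exact: Theta_continuous.
have cS : compact S.
  apply: (bounded_closed_compact_expand tE (M := B + `|p|)) => [|s [sB _]].
    apply: closedI.
      by apply: (@closed_comp _ _ (fun v => `|v - p|) [set r | r <= B]) => [v _|];
        [exact: cnorm|exact: closed_le].
    by apply: (@closed_comp _ _ (dist Gamma) [set r | eps <= r]) => [v _|];
        [exact: cdist|exact: closed_ge].
  by rewrite -[in leLHS](subrK p s) (le_trans (ler_normD _ _))// lerD2r.
have [||d d0 dS] := @compact_pos_min _ _ S
    (fun v => Num.max (Theta (relax a T v) - Theta p) `|v - T v|) cS.
- move=> v; apply: (@continuous_max _ _ (fun v => Theta (relax a T v) - Theta p)
    (fun v => `|v - T v|)); [exact: crel|exact: residual_continuous].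
- move=> v [_ /= dv]; rewrite lt_max; apply/orP.
  have [vT|vT] := eqVneq (v - T v) 0; last by right; rewrite normr_gt0.
  left; have {}vT : Fix T v by apply/eqP; rewrite eq_sym -subr_eq0 vT.
  rewrite relax_Fix// ltNge; apply/negP => le0.
  have : Gamma v.
    split=> // y yT; apply: le_trans (pmin y yT); rewrite lee_fin; lra.
  by move=> /(dist_le v); rewrite subrr normr0; lra.
exists d => // v vB dv; have := dS v (conj vB dv).
by rewrite le_max => /orP[->|->]; [left|right].
Qed.

(** An iterate away from Gamma has a large residual or a large objective value.
    In the first case the relaxed step gains a fixed amount, which exceeds the
    possible loss of order lam_n of the gradient step; in the second case the
    gradient step gains a multiple of lam_n, up to a term of order lam_n^2. So
    the squared distance to Gamma satisfies [cvg0_of_decrease]. *)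
Lemma hsdm_converges (M : R) :
  Gamma !=set0 -> (forall x, Fix T x -> `|x| <= M) ->
  forall eps : R, 0 < eps ->
    exists N : nat, forall n, (N <= n)%N -> dist Gamma (w n) <= eps.
Proof.
move=> G0 MT; have [p Gp] := G0; have [pT pmin] := Gp; have /andP[a0 a1] := a01.
have [B [N0 zB]] := iterates_bounded pT MT.
have B0 : 0 <= B by apply: le_trans (zB N0 (leqnn _)).
have [_ _ dlam] := hlam.
have [N1 lam1] := vanishing_le lam_cvg0 ltr01.
have wz n y : Fix T y -> `|w n - y| <= `|z n - y|.
  by move=> yT; rewrite -{1}(relax_Fix a yT); exact: relax_nonexpansive.
pose C1 := `|G p| + `|L| * B.
have C10 : 0 <= C1 by rewrite addr_ge0// mulr_ge0.
have GB n : (N0 <= n)%N -> `|G (w n)| <= C1.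
  move=> Nn; have : `|G (w n)| <= `|G p| + `|G (w n) - G p|.
    by rewrite -{1}(subrKC (G p) (G (w n))) ler_normD.
  move=> /le_trans; apply; rewrite lerD2l; apply: le_trans (LG _ _) _.
  apply: le_trans (ler_wpM2r (normr_ge0 _) (ler_norm L)) _; rewrite ler_wpM2l//.
  exact: le_trans (wz _ _ pT) (zB _ Nn).
pose b := a * (1 - a); have b0 : 0 < b by rewrite mulr_gt0// subr_gt0.
pose D n := dist Gamma (z n) ^+ 2.
have Dstep n : (N0 <= n)%N -> D n.+1 <= D n + (- b * `|z n - T (z n)| ^+ 2
    - 2 * lam n * (Theta (w n) - Theta p) + lam n ^+ 2 * C1 ^+ 2).
  move=> Nn; apply: dist_sqr_le => // y [yT ymin].
  have -> : Theta p = Theta y.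
    apply/eqP; rewrite eq_le -!lee_fin; apply/andP.
    by split; [exact: pmin|exact: ymin].
  apply: le_trans (step_sqr_le n yT) _.
  have : lam n ^+ 2 * `|G (w n)| ^+ 2 <= lam n ^+ 2 * C1 ^+ 2.
    by rewrite ler_wpM2l ?sqr_ge0// ler_sqr ?nnegrE//; exact: GB.
  by rewrite -/b; lra.
have low n : (N0 <= n)%N -> - (Theta (w n) - Theta p) <= `|G p| * B.
  move=> Nn; have := hG p (w n); have := norm_cauchy_schwarz (G p) (w n - p).
  have := ler_norm (- inner (G p) (w n - p)); rewrite normrN.
  have := ler_wpM2l (normr_ge0 (G p)) (le_trans (wz _ _ pT) (zB _ Nn)).
  by lra.
pose N := maxn N0 N1; pose C := 2 * (`|G p| * B) + C1 ^+ 2.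
have C0 : 0 <= C by rewrite addr_ge0 ?sqr_ge0// !mulr_ge0.
have lamsq n : (N1 <= n)%N -> lam n ^+ 2 * C1 ^+ 2 <= lam n * C1 ^+ 2.
  by move=> Nn; rewrite ler_wpM2r ?sqr_ge0// expr2 ler_piMl ?lam0 ?lam1.
have NE n : (N <= n)%N -> (N0 <= n)%N /\ (N1 <= n)%N.
  by rewrite /N geq_max => /andP[-> ->].
have up n : (N <= n)%N -> D n.+1 <= D n - b * `|z n - T (z n)| ^+ 2 + C * lam n.
  move=> /NE[h0 h1]; apply: le_trans (Dstep n h0) _.
  have := ler_wpM2l (lam0 n) (low n h0); have := lamsq n h1.
  by rewrite /C; lra.
have Dcvg : forall e : R, 0 < e -> exists N, forall n, (N <= n)%N -> D n <= e.
  apply: (cvg0_of_decrease (N0 := N) (C := C) lam0) => //.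
  - by move=> n; exact: sqr_ge0.
  - move=> n Nn; apply: le_trans (up n Nn) _.
    by have := mulr_ge0 (ltW b0) (sqr_ge0 `|z n - T (z n)|); lra.
  move=> e e0; have se0 : 0 < Num.sqrt e by rewrite sqrtr_gt0.
  have [d d0 hd] := progress_away_from_solutions B Gp se0.
  have C1' : 0 < C1 ^+ 2 + 1 by rewrite ltr_wpDl// sqr_ge0.
  have C2' : 0 < C + d by rewrite ltr_wpDl.
  have bd0 : 0 < b * d ^+ 2 by rewrite mulr_gt0// exprn_gt0.
  have [N2 hN2] := vanishing_le lam_cvg0 (divr_gt0 d0 C1').
  have [N3 hN3] := vanishing_le lam_cvg0 (divr_gt0 bd0 C2').
  exists d, (maxn N (maxn N2 N3)); split => // n.
  rewrite !geq_max => /andP[/andP[n0 n1] /andP[n2 n3]] De.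
  have Nn : (N <= n)%N by rewrite /N geq_max n0 n1.
  have dist_e : Num.sqrt e <= dist Gamma (z n).
    by rewrite -[leRHS]ger0_norm ?dist_ge0// -sqrtr_sqr ler_wsqrtr.
  have [Td|rd] := hd _ (zB n n0) dist_e.
    apply: le_trans (Dstep n n0) _.
    have := ler_wpM2l (lam0 n) Td.
    have := hN2 n n2; rewrite ler_pdivlMr// => /(ler_wpM2l (lam0 n)).
    have := mulr_ge0 (ltW b0) (sqr_ge0 `|z n - T (z n)|).
    by have := sqr_ge0 (lam n); lra.
  apply: le_trans (up n Nn) _.
  have := hN3 n n3; rewrite ler_pdivlMr//.
  have : b * d ^+ 2 <= b * `|z n - T (z n)| ^+ 2.
    by rewrite ler_wpM2l ?(ltW b0)// ler_sqr ?nnegrE// ltW.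
  by lra.
move=> eps eps0; have [N2 hN2] := Dcvg (eps ^+ 2) (exprn_gt0 2 eps0).
exists N2 => n /hN2; rewrite /D ler_sqr ?nnegrE ?dist_ge0 ?(ltW eps0)//.
apply: le_trans; apply: dist_mono => // y Gy; exists y => //.
by apply: wz; case: Gy.
Qed.

End hybrid_steepest_descent.

(** * Douglas-Rachford splitting with hybrid steepest descent *)

Theorem theorem15 (R : realType) (X K : hilbertType R)
    (f : X -> \bar R) (g : K -> \bar R) (A : {linear X -> K}) (Psi : X -> R)
    (Sp := argmin setT (fun x => (f x + g (A x))%E))
    (Omega := argmin Sp (fun x => (Psi x)%:E)) :
  gamma0 f -> gamma0 g -> bounded_operator A ->
  Sp !=set0 ->
  sri [set y - A x | y in edom g & x in edom f] 0 ->
  gamma0 (fun x => (Psi x)%:E) ->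
  gateaux_differentiable Psi ->
  (exists kappa : R, kappa.-lipschitz (gradient Psi)) ->
  Omega !=set0 ->
  forall (alpha : R) (lambda : R^nat),
    0 < alpha < 1 ->
    l2_not_l1 (fun n => lambda n.+1) ->
  forall (x0 : X) (y0 : K) (x : nat -> X) (y : nat -> K)
    (xh : nat -> X) (yh : nat -> K) (xs : nat -> X),
    x 0%N = x0 -> y 0%N = y0 ->
    hsdm_DRS1 f g A Psi alpha lambda x y xh yh xs ->
  hsdm (relax alpha (DRS1 f g A)) (Psi \o Xi A) lambda
       (fun n => (x n, y n) : hprod X K)
  /\ (finite_dim (hprod X K) -> bounded_set (Fix (DRS1 f g A)) ->
      dist Omega (xs n) @[n --> \oo] --> 0).
Proof.
move=> gf gg bA Sp0 qual gPsi dPsi [kappa lipPsi] Omega0 a lam a01 hlam.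
move=> x0 y0 x y xh yh xs _ _ iter.
have Tne := DRS1_nonexpansive bA gf gg; set T := DRS1 f g A in iter Tne *.
have cPsi : econvex (fun x => (Psi x)%:E) by case: gPsi.
have cTheta := econvex_comp_Xi bA cPsi; set Theta := Psi \o Xi A in cTheta *.
have dTheta : gateaux_differentiable Theta.
  by move=> z; have [gz hz] := dPsi (Xi A z); exists (Xi_adjoint A gz);
    exact: is_gradient_comp_Xi.
pose z n : hprod X K := (x n, y n); pose w n := relax a T (z n).
have wE n : w n = (xh n, yh n) by have [-> _ _ _] := iter n.
have xsE n : xs n.+1 = Xi A (w n) by have [_ -> _ _] := iter n; rewrite wE.
have zE n : z n.+1 = w n - lam n.+1 *: gradient Theta (w n).
  rewrite gradient_comp_Xi// -xsE /z; have [_ _ -> ->] := iter n.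
  by rewrite wE.
split.
  split => //; apply/lipschitzP => u v; rewrite mul1r; exact: relax_nonexpansive.
move=> fd bFix.
have [t tE] := finite_dim_expand fd.
have tKE k : expand [seq u.2 | u <- t] k = k by rewrite expand_snd tE.
have hG u v : Theta u + inner (gradient Theta u) (v - u) <= Theta v.
  by apply: convex_gradient_le => //; exact: gradientP.
have LG u v : `|gradient Theta u - gradient Theta v| <= `|kappa| * `|u - v|.
  rewrite !gradient_comp_Xi//; apply: le_trans (Xi_adjoint_lipschitz bA _ _) _.
  have /lipschitzP lip := lipPsi; apply: le_trans (lip _ _) _.
  apply: le_trans (ler_wpM2r (normr_ge0 _) (ler_norm kappa)) _.
  by rewrite ler_wpM2l// -(XiB bA) Xi_norm_le.
have FixSp u : Fix T u -> Sp (Xi A u) by exact: Fix_DRS1_argmin.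
have SpFix u : Sp u -> exists2 v, Fix T v & Xi A v = u.
  move=> Su; have [nu [hg hf]] := lagrange_multiplier bA gf gg tKE qual Su.
  by have [v [vT vu]] := Fix_DRS1_multiplier bA gf gg hg hf; exists v.
pose Gamma := argmin (Fix T) (fun v => (Theta v)%:E).
have Gamma0 : Gamma !=set0.
  have [u [/SpFix[v vT vu] umin]] := Omega0; exists v; split=> // v' v'T.
  by rewrite /Theta/= vu; apply: umin; exact: FixSp.
have GammaOmega v : Gamma v -> Omega (Xi A v).
  move=> [vT vmin]; split; first exact: FixSp.
  by move=> _ /SpFix[v' v'T <-]; exact: vmin.
have [M [_ MFix]] := bFix.
have M1 : M < M + 1 by rewrite ltrDl.
have conv := hsdm_converges tE Tne hG LG a01 hlam zE Gamma0 (MFix (M + 1) M1).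
apply/cvgrPdist_le => e e0; have [N hN] := conv e e0.
exists N.+1 => // -[//|n] /= Nn; rewrite sub0r normrN ger0_norm ?dist_ge0//.
apply: le_trans (hN n Nn); apply: dist_mono => // v Gv.
exists (Xi A v); first exact: GammaOmega.
by rewrite xsE -(XiB bA) Xi_norm_le.
Qed.
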